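(* A finite simple graph $\Gamma$ is isomorphic to the prime graph of a pseudo $\mathrm{PSL}(3,3)$-solvable group if and only if its complement $\overline{\Gamma}$ is $3$-colorable and triangle-free.
   Context: All groups are finite and all graphs are simple. For a finite group $G$, the prime graph $\Gamma(G)$ has as vertices the prime divisors of $|G|$; two distinct vertices $p,q$ are adjacent if and only if $G$ contains an element of order $pq$. A group is pseudo $\mathrm{PSL}(3,3)$-solvable if each of its composition factors is abelian or isomorphic to $\mathrm{PSL}(3,3)$ (in particular solvable groups are allowed). *)

(* Defs.v *)
From HB Require Import structures.
From mathcomp Require Import all_boot all_order all_algebra all_fingroup.
From mathcomp Require Import all_solvable.

Set Implicit Arguments.
Unset Strict Implicit.
Unset Printing Implicit Defensive.

Import GroupScope.

(* The vertex set may be empty: the prime graph of the trivial group is the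
   empty graph. *)
Record sgraph := SGraph {
  vertex : finType;
  edge : rel vertex;
  edge_sym : symmetric edge;
  edge_irrefl : irreflexive edge
}.

Definition graph_iso (A B : sgraph) : Prop :=
  exists2 f : vertex A -> vertex B,
    bijective f & forall x y, edge (f x) (f y) = edge x y.

Section Complement.
Variable A : sgraph.

Definition compl_edge : rel (vertex A) :=
  fun x y => (x != y) && ~~ edge x y.

Lemma compl_edge_sym : symmetric compl_edge.
Proof. by move=> x y; rewrite /compl_edge eq_sym edge_sym. Qed.

Lemma compl_edge_irrefl : irreflexive compl_edge.
Proof. by move=> x; rewrite /compl_edge eqxx. Qed.

Definition complement : sgraph := SGraph compl_edge_sym compl_edge_irrefl.
End Complement.

Definition colorable (k : nat) (A : sgraph) : Prop :=
  exists c : vertex A -> 'I_k, forall x y, edge x y -> c x != c y.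

(* Irreflexivity makes three pairwise adjacent vertices distinct. *)
Definition triangle_free (A : sgraph) : Prop :=
  forall x y z : vertex A, ~~ [&& edge x y, edge y z & edge x z].

Section PrimeGraph.
Variables (gT : finGroupType) (G : {group gT}).

Definition prime_edge : rel (seq_sub (primes #|G|)) :=
  fun p q => (p != q) && [exists x in G, #[x] == (val p * val q)%N].

Lemma prime_edge_sym : symmetric prime_edge.
Proof. by move=> p q; rewrite /prime_edge eq_sym mulnC. Qed.

Lemma prime_edge_irrefl : irreflexive prime_edge.
Proof. by move=> p; rewrite /prime_edge eqxx. Qed.

Definition prime_graph : sgraph := SGraph prime_edge_sym prime_edge_irrefl.
End PrimeGraph.

(* As for GLgroup, the matrices have size n.-1.+1, which is n when n > 0. *)
Section SpecialLinear.
Variables (n : nat) (R : finComUnitRingType).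

Definition SLgroup : {set {'GL_n[R]}} := [set u | (\det (GLval u) == 1)%R].

Lemma SLgroup_group_set : group_set SLgroup.
Proof.
apply/group_setP; split=> [|u v]; first by rewrite inE GL_1E det1.
by rewrite !inE GL_ME det_mulmx => /eqP-> /eqP->; rewrite GRing.Theory.mulr1.
Qed.

Canonical SLgroup_group : {group {'GL_n[R]}} := Group SLgroup_group_set.

Definition PSLgroup : {group coset_of 'Z(SLgroup)} := (SLgroup / 'Z(SLgroup))%G.
End SpecialLinear.

Definition PSL33 := PSLgroup 3 'F_3.

(* By JordanHolderUniqueness the choice of composition series is immaterial,
   and one exists by exists_comps. *)
Definition pseudo_PSL33_solvable (gT : finGroupType) (G : {group gT}) : Prop :=
  forall s : seq {group gT}, comps G s ->
  forall K : section gT, K \in mkfactors G s ->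
  abelian K || (K \isog PSL33).

(* Main.v *)
Require Import Defs.
From HB Require Import structures.
From mathcomp Require Import all_boot all_order all_algebra all_fingroup.
From mathcomp Require Import all_solvable all_field.
From mathcomp Require integral_char.

(** Call two primes dividing |G| nonadjacent when they are not joined in the
    prime graph.

    Solvable groups. If p, q, r are pairwise nonadjacent, then in a Hall
    subgroup a p-subgroup V, a q-subgroup M and an element x of order r appear
    (in some order) with M acting on V and x acting on both, all actions being
    fixed point free; summing the conjugates of v in V over M<x> gives
    v^|M| = 1, a contradiction. For nonadjacent p and q, orient p -> q when a
    Sylow p-subgroup normalizes some q-subgroup V <> 1; one of p -> q, q -> p
    holds, and p -> q makes the Sylow p-subgroups cyclic or quaternion. A walk
    p -> q -> r -> s would make all Sylow subgroups of a Hall {p,q,r}-subgroup K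
    cyclic, so that K' is abelian, while q and r both divide |K'|. Hence the
    length of the longest walk leaving a prime is a 3-coloring.

    Nonsolvable groups. A section PSL(3,3) makes 2 and 3 adjacent to each other
    and to every prime other than 13, and there is a solvable subgroup whose
    order is divisible by all primes of |G| except possibly 2 and 3.

    Converse. Process the vertices by increasing color, replacing G by a
    semidirect product of G with an F_r-module induced from a linear character
    of a normal subgroup, where r = 1 mod |G| is the prime of the new vertex.
    For an independent set A of vertices of the first two colors the groups
    constructed retain a normal subgroup K and a linear character of K that is
    nontrivial on exactly the elements of prime order belonging to A. *)

Set Implicit Arguments.
Unset Strict Implicit.
Unset Printing Implicit Defensive.

Import GroupScope.

(** * Prime adjacency and norm sums *)

(** Taken over all numbers instead of the vertices of [prime_graph], so that one pair of primes can
    be compared in subgroups and quotients. For p = q it concerns elements of order p^2, whence the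
    distinctness hypotheses below. *)
Definition adj (gT : finGroupType) (G : {set gT}) (p q : nat) :=
  [exists x in G, #[x] == (p * q)%N].

Section Adjacency.
Variable gT : finGroupType.
Implicit Types (G H : {group gT}) (p q : nat).

Lemma adjC G p q : adj G p q = adj G q p.
Proof. by rewrite /adj mulnC. Qed.

Lemma adj_sub G H p q : H \subset G -> adj H p q -> adj G p q.
Proof.
move=> sHG /exists_inP[x Hx ox]; apply/exists_inP; exists x => //.
exact: (subsetP sHG).
Qed.

Lemma adj_dvd_order G p q x :
  x \in G -> 0 < p * q -> p * q %| #[x] -> adj G p q.
Proof.
move=> Gx pq_gt0 /dvdnP[k ox]; apply/exists_inP; exists (x ^+ k).
  exact: groupX.
by rewrite orderXdiv ox ?dvdn_mulr // mulKn // lt0n; apply: contraTneq isT => k0;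
   move: (order_gt0 x); rewrite ox k0.
Qed.

Lemma adj_commute G p q x y : prime p -> prime q -> p != q ->
  x \in G -> y \in G -> commute x y -> p %| #[x] -> q %| #[y] -> adj G p q.
Proof.
move=> p_pr q_pr neq_pq Gx Gy cxy /dvdnP[k ox] /dvdnP[l oy].
have xk : #[x ^+ k] = p.
  rewrite orderXdiv ox ?dvdn_mulr // mulKn // lt0n; apply/eqP => k0.
  by move: (order_gt0 x); rewrite ox k0.
have yl : #[y ^+ l] = q.
  rewrite orderXdiv oy ?dvdn_mulr // mulKn // lt0n; apply/eqP => k0.
  by move: (order_gt0 y); rewrite oy k0.
apply/exists_inP; exists (x ^+ k * y ^+ l); first by rewrite groupM ?groupX.
rewrite orderM ?xk ?yl //; first exact/commuteX2.
by rewrite prime_coprime // dvdn_prime2.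
Qed.

Lemma adj_cent_pgroup G p q (V : {group gT}) x :
    prime p -> prime q -> p != q -> V \subset G -> q.-group V ->
    x \in G -> #[x] = p -> 'C_V[x] != 1 -> adj G p q.
Proof.
move=> p_pr q_pr neq_pq sVG qV Gx ox /trivgPn[y /setIP[Vy cxy] nty].
apply: (@adj_commute G p q x y) => //.
- exact: (subsetP sVG).
- by apply: commute_sym; apply/cent1P.
- by rewrite ox.
have /p_natP[[|k] oy] : q.-nat #[y] by apply: mem_p_elt Vy.
  by rewrite -order_eq1 oy in nty.
by rewrite oy expnS dvdn_mulr.
Qed.

End Adjacency.

(** Orders in the image divide orders of preimages, so a power of a preimage has order p * q. This
    lifts adjacency from quotients. *)
Lemma adj_morphim (gT rT : finGroupType) (D : {group gT})
    (f : {morphism D >-> rT}) (G : {group gT}) p q :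
  0 < p * q -> G \subset D -> adj (f @* G) p q -> adj G p q.
Proof.
move=> pq0 sGD /exists_inP[_ /morphimP[x Dx Gx ->] /eqP ofx].
by apply: (@adj_dvd_order _ G p q x) => //; rewrite -ofx morph_order.
Qed.

Section NormSums.
Variables (gT : finGroupType) (V : {group gT}).
Hypothesis abV : abelian V.
Import FiniteModule.
Local Notation fmV := (fmod abV).

(** The sum is invariant under [x], which permutes its terms cyclically, and 0 is the only
    invariant. *)
Lemma norm_cycle_eq0 (v : fmod_of abV) x n :
  x \in 'N(V) -> x ^+ n.+1 = 1 -> 'C_V[x] = 1 ->
  (\sum_(i < n.+1) v ^@ (x ^+ i) = 0)%R.
Proof.
move=> nVx xn1 CVx; set u := (\sum_(i < _) _)%R.
have ux : (u ^@ x = u)%R.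
  rewrite {1}/u big_ord_recr /= actAr -actrM ?groupX // -expgSr xn1 actr1.
  rewrite /u big_ord_recl expg0 actr1 GRing.addrC; congr (_ + _)%R.
  rewrite (@big_morph _ _ _ _ _ _ _ (@actAr _ _ abV x) (@act0r _ _ abV x)).
  by apply: eq_bigr => i _; rewrite -actrM ?groupX // -expgSr.
apply: fmod_inj => /=; apply/set1gP; rewrite -CVx inE fmodP /=.
apply/cent1P/commgP/conjg_fixP.
by have /= := congr1 (fun w => fmval w) ux; rewrite fmvalJcond nVx.
Qed.

Lemma norm_group_eq0 (v : fmod_of abV) (M : {group gT}) :
  M \subset 'N(V) -> 'C_V(M) = 1 -> (\sum_(m in M) v ^@ m = 0)%R.
Proof.
move=> nVM CVM; set u := (\sum_(i in _) _)%R.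
have ux x : x \in M -> (u ^@ x = u)%R.
  move=> Mx; rewrite {1}/u (@big_morph _ _ _ _ _ _ _ (@actAr _ _ abV x) (@act0r _ _ abV x)).
  rewrite /u [RHS](reindex_inj (mulIg x)) /=.
  apply: eq_big => [m|m Mm]; first by rewrite groupMr.
  by rewrite actrM // (subsetP nVM).
apply: fmod_inj => /=; apply/set1gP; rewrite -CVM inE fmodP /=.
apply/centP => x Mx; apply/commgP/conjg_fixP.
by have /= := congr1 (fun w => fmval w) (ux x Mx); rewrite fmvalJcond (subsetP nVM).
Qed.

(* Summing the vanishing norms of the elements [rho m] leaves, besides the      *)
(* #|M| identity terms, only sums that are norms over [M] in disguise.          *)
Lemma fixfree_cover_exp (M : {group gT}) (rho : gT -> gT) r (v : gT) :
    M \subset 'N(V) -> 'C_V(M) = 1 -> 0 < r ->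
    {in M, forall m, [/\ rho m \in 'N(V), rho m ^+ r = 1 & 'C_V[rho m] = 1]} ->
    (forall i, 0 < i < r -> exists2 y, y \in 'N(V) & exists2 g,
       {in M &, injective g} &
       {in M, forall m, g m \in M /\ rho m ^+ i = y * g m}) ->
  v \in V -> v ^+ #|M| = 1.
Proof.
case: r => // n nVM CVM _ rhoP rhoX Vv.
have S0 : (\sum_(m in M) \sum_(i < n.+1) fmV v ^@ (rho m ^+ i) = 0)%R.
  by apply: big1 => m /rhoP[nVm mn1 CVm]; apply: norm_cycle_eq0.
rewrite exchange_big big_ord_recl /= in S0.
rewrite (eq_bigr (fun _ => fmV v)) in S0; last by move=> m _; rewrite expg0 actr1.
have T0 : (\sum_(i < n) \sum_(m in M) fmV v ^@ (rho m ^+ lift ord0 i) = 0)%R.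
  apply: big1 => i _.
  have [//|y nVy [g g_inj gP]] := rhoX (lift ord0 i).
    by rewrite /= /bump leq0n add1n ltnS /=.
  have gM : g @: M = M.
    apply/eqP; rewrite eqEcard card_in_imset // leqnn andbT.
    by apply/subsetP=> _ /imsetP[m Mm ->]; case: (gP m Mm).
  have := @norm_group_eq0 (fmV v ^@ y) M nVM CVM; rewrite -[in X in X -> _]gM.
  rewrite big_imset //= => S1; rewrite -[RHS]S1.
  apply: eq_bigr => m Mm; have [Mgm ->] := gP m Mm.
  by rewrite actrM // (subsetP nVM).
move: S0; rewrite T0 GRing.addr0 GRing.sumr_const => S0.
by rewrite -(fmodK abV Vv) -fmvalZ S0.
Qed.

End NormSums.

(** * Fixed point free actions on p-groups *)

Section Semiregular.
Variable gT : finGroupType.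
Implicit Types (G H K M P Q V : {group gT}).

Lemma coprime_expg_eq1 V n v :
  v \in V -> coprime #|V| n -> v ^+ n = 1 -> v = 1.
Proof.
move=> Vv coVn /eqP vn1; apply/eqP; rewrite -order_eq1 -dvdn1.
rewrite -(eqnP coVn) dvdn_gcd order_dvdG //.
by rewrite order_dvdn.
Qed.

Lemma coprime_pgroups (p q : nat) V M :
  prime p -> prime q -> p != q -> p.-group V -> q.-group M -> coprime #|V| #|M|.
Proof.
move=> p_pr q_pr neq_pq pV qM; apply: (pnat_coprime pV).
by apply: sub_in_pnat qM => t _ /eqnP->; rewrite !inE eq_sym.
Qed.

Lemma cent1_pgroup_trivial G (p q : nat) V x :
    prime p -> prime q -> p != q -> ~~ adj G p q -> V \subset G ->
  q.-group V -> x \in G -> #[x] = p -> 'C_V[x] = 1.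
Proof.
move=> p_pr q_pr neq_pq nadj sVG qV Gx ox; apply/eqP/idPn => ntC.
by case/negP: nadj; apply: adj_cent_pgroup ntC.
Qed.

Lemma center_norm V x : x \in 'N(V) -> x \in 'N('Z(V)).
Proof. by rewrite -!sub1set; apply: char_norm_trans (center_char V). Qed.

Lemma center_pgroup_neq1 (p : nat) V : p.-group V -> V :!=: 1 -> 'Z(V) :!=: 1.
Proof. by move=> pV; apply: contraNneq => Z1; rewrite (trivg_center_pgroup pV Z1). Qed.

(** Let z be a central element of order p of P. An element x of order p outside <z> would give a
    fixed point free action of the rank 2 group <x, z> on the abelian q-group Z(V); summing over its
    subgroups of order p gives v^p = 1 there. Hence Ohm_1(P) = <z>, which forces P to be cyclic or
    quaternion. *)
Lemma rank1_of_nonadj G (p q : nat) P V :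
    prime p -> prime q -> p != q -> ~~ adj G p q -> P \subset G -> V \subset G ->
    p.-group P -> q.-group V -> V :!=: 1 -> P \subset 'N(V) ->
  cyclic P || (p == 2) && (extremal_class P == Quaternion).
Proof.
move=> p_pr q_pr neq_pq nadj sPG sVG pP qV ntV nVP.
have [P1|ntP] := boolP (P :==: 1); first by rewrite (eqP P1) cyclic1.
apply/(prime_Ohm1P pP ntP).
have ntZ := center_pgroup_neq1 pP ntP.
have [_ p_dv_Z _] := pgroup_pdiv (pgroupS (center_sub P) pP) ntZ.
have [z Zz oz] := Cauchy p_pr p_dv_Z.
have Pz : z \in P := subsetP (center_sub P) z Zz.
suffices sOz : 'Ohm_1(P) = <[z]> by rewrite sOz -orderE.
apply/eqP; rewrite eqEsubset (OhmE 1 pP); apply/andP; split; last first.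
  by rewrite cycle_subG mem_gen // !inE Pz expn1 -oz expg_order eqxx.
rewrite gen_subG; apply/subsetP=> x /setIP[Px]; rewrite !inE expn1 => xp1.
apply/idPn => nzx.
have czx : commute x z by case/centerP: Zz => _ /(_ x Px) /commute_sym.
have sZG : 'Z(V) \subset G := subset_trans (center_sub V) sVG.
have qZ : q.-group 'Z(V) := pgroupS (center_sub V) qV.
have CV y : y \in P -> y ^+ p = 1 -> y != 1 -> 'C_('Z(V))[y] = 1.
  move=> Py yp1 nty; apply: (@cent1_pgroup_trivial G p q) => //.
    exact: (subsetP sPG).
  by apply/nt_prime_order.
have cycz m : m \in <[z]> -> exists j, m = z ^+ j by case/cycleP=> j ->; exists j.
have nVz y : y \in P -> y \in 'N('Z(V)) by move=> Py; apply/center_norm/(subsetP nVP).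
case/negP: (center_pgroup_neq1 qV ntV); apply/eqP/trivgP/subsetP => v Zv.
apply/set1gP; apply: (coprime_expg_eq1 (n := #|<[z]>|) Zv).
  apply: (@coprime_pgroups q p) => //; first by rewrite eq_sym.
  by apply: pgroupS pP; rewrite cycle_subG.
(* The elements x * m generate the subgroups of order p of <x, z> other than <z>. Their i-th powers
   are x ^+ i times m ^+ i, and m |-> m ^+ i permutes <z> when 0 < i < p. *)
apply: (@fixfree_cover_exp _ _ (center_abelian V) _ (fun m => x * m) p) => //.
- by rewrite cycle_subG nVz.

- rewrite cent_cycle; apply: CV => //; first by rewrite -oz expg_order.
  by rewrite -order_gt1 oz prime_gt1.
- exact: prime_gt0.
- move=> m mz; have [j def_m] := cycz m mz; have Pm : m \in P by rewrite def_m groupX.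
  have xm1 : (x * m) ^+ p = 1.
    rewrite expgMn ?(eqP xp1) ?mul1g def_m; last exact: commuteX.
    by rewrite -expgM mulnC expgM -oz expg_order expg1n.
  split=> //; first by rewrite nVz // groupM.
  apply: CV => //; first by rewrite groupM.
  by apply: contra nzx => xm; rewrite -(mulgK m x) (eqP xm) mul1g groupV.
move=> i /andP[i_gt0 i_ltp]; exists (x ^+ i); first by rewrite nVz ?groupX.
exists (fun m => m ^+ i).
  have co_i : coprime #|<[z]>| i.
    by rewrite -orderE oz prime_coprime // gtnNdvd.
  move=> m1 m2 m1z m2z /= eqm; rewrite -(expgK co_i m1z) -(expgK co_i m2z).
  by rewrite eqm.
move=> m mz; split; first exact: groupX.
by rewrite expgMn //; have [j ->] := cycz m mz; apply: commuteX.
Qed.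

Lemma cycle_expg_prime (x : gT) r i :
  prime r -> #[x] = r -> 0 < i < r -> <[x ^+ i]> = <[x]>.
Proof.
move=> r_pr ox /andP[i_gt0 i_ltr].
apply/eqP; rewrite eqEcard cycleX -!orderE orderXgcd ox.
suffices /eqP->: coprime r i by rewrite divn1 leqnn.
by rewrite prime_coprime // gtnNdvd.
Qed.

Lemma cent1_expg_prime (V : {group gT}) x r i :
  prime r -> #[x] = r -> 0 < i < r -> 'C_V[x ^+ i] = 'C_V[x].
Proof. by move=> r_pr ox i_r; rewrite -!cent_cycle (cycle_expg_prime r_pr ox i_r). Qed.

(** In the Frobenius group M<x> the conjugates x ^ m of x generate the complements; they play the
    role of [rho] in [fixfree_cover_exp]. *)
Lemma frobenius_action_exp (V M : {group gT}) x r v :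
    abelian V -> abelian M -> M \subset 'N(V) -> x \in 'N(V) -> x \in 'N(M) ->
    prime r -> #[x] = r -> 'C_M[x] = 1 -> 'C_V(M) = 1 -> 'C_V[x] = 1 ->
  v \in V -> v ^+ #|M| = 1.
Proof.
move=> abV abM nVM nVx nMx r_pr ox CMx CVM CVx.
apply: (@fixfree_cover_exp _ _ abV _ (fun m => x ^ m) r) => //.
- exact: prime_gt0.
- move=> m Mm; have nVm := subsetP nVM m Mm; split.
  + by rewrite groupJ.
  + by rewrite -conjXg -ox expg_order conj1g.
  by rewrite -(normP nVm) cent1J -conjIg CVx conjs1g.
move=> i i_r; exists (x ^+ i); first exact: groupX.
(* (x ^ m) ^+ i = x ^+ i * [~ x ^+ i, m], and the commutator is injective in m because x ^+ i
   centralizes only 1 in [M]. *)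
exists (fun m => [~ x ^+ i, m]).
  move=> m1 m2 Mm1 Mm2 /= eqm.
  have /eqP: x ^+ i * [~ x ^+ i, m1] = x ^+ i * [~ x ^+ i, m2] by rewrite eqm.
  rewrite -!conjg_mulR => /eqP eqJ.
  have : m1 * m2^-1 \in 'C_M[x ^+ i].
    rewrite inE groupM ?groupV //=; apply/cent1P; apply: commute_sym.
    by apply/commgP/conjg_fixP; rewrite conjgM eqJ conjgK.
  by rewrite (cent1_expg_prime _ r_pr ox i_r) CMx => /set1gP/eqP; rewrite -eq_mulgV1 => /eqP.
move=> m Mm; split; last by rewrite -conjXg conjg_mulR.
rewrite commgEr groupM //= ?memJ_norm ?groupX //= groupV //.
Qed.

End Semiregular.

(** * Solvable groups *)

Section Solvable.
Variable gT : finGroupType.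
Implicit Types (G H K M P Q R V : {group gT}) (p q r s t : nat).

Lemma pgroup_order_prime q V : q.-group V -> V :!=: 1 -> exists2 x, x \in V & #[x] = q.
Proof.
move=> qV ntV; have [q_pr q_dv _] := pgroup_pdiv qV ntV.
by have [x Vx ox] := Cauchy q_pr q_dv; exists x.
Qed.

(** Without adjacency, all actions among Z(V), Z(M) and x are fixed point free. Then elements of the
    p-group Z(V) have exponent dividing |Z(M)|, a power of q, so Z(V) is trivial. *)
Lemma frobenius_adj G p q r V M x :
    prime p -> prime q -> prime r -> p != q -> q != r -> p != r ->
    V \subset G -> M \subset G -> x \in G ->
    p.-group V -> V :!=: 1 -> q.-group M -> M :!=: 1 -> #[x] = r ->
    M \subset 'N(V) -> x \in 'N(V) -> x \in 'N(M) ->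
  [|| adj G p q, adj G q r | adj G p r].
Proof.
move=> p_pr q_pr r_pr npq nqr npr sVG sMG Gx pV ntV qM ntM ox nVM nVx nMx.
apply/idPn; rewrite !negb_or => /and3P[nadjpq nadjqr nadjpr].
have sZVG : 'Z(V) \subset G := subset_trans (center_sub V) sVG.
have pZV : p.-group 'Z(V) := pgroupS (center_sub V) pV.
have sZMG : 'Z(M) \subset G := subset_trans (center_sub M) sMG.
have qZM : q.-group 'Z(M) := pgroupS (center_sub M) qM.
have ntZM := center_pgroup_neq1 qM ntM.
case/negP: (center_pgroup_neq1 pV ntV); apply/eqP/trivgP/subsetP => v Zv.
apply/set1gP; apply: (coprime_expg_eq1 (n := #|'Z(M)|) Zv).
  exact: (@coprime_pgroups _ p q).
apply: (@frobenius_action_exp _ 'Z(V)%G 'Z(M)%G x r) => //; try exact: center_abelian.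
- apply/subsetP=> m Zm; apply: center_norm; apply: (subsetP nVM).
  exact: (subsetP (center_sub M)).
- exact: center_norm.
- exact: center_norm.
- by apply: (@cent1_pgroup_trivial _ G r q) => //; rewrite 1?eq_sym // adjC.
- have [m Zm om] := pgroup_order_prime qZM ntZM.
  apply/trivgP; rewrite -(@cent1_pgroup_trivial _ G q p 'Z(V)%G m) //; first last.
  + exact: (subsetP sZMG).
  + by rewrite adjC.
  + by rewrite eq_sym.
  by apply: setIS; rewrite -cent_cycle centS // cycle_subG.
by apply: (@cent1_pgroup_trivial _ G r p) => //; rewrite 1?eq_sym // adjC.
Qed.

Lemma sol_pcore_neq1 G : solvable G -> G :!=: 1 ->
  exists t, [/\ prime t, t %| #|G| & 'O_t(G) != 1].
Proof.
move=> solG ntG.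
have [M minM sMG] := minnormal_exists ntG (normG G).
have [_ ntM /is_abelemP[t t_pr abM]] := minnormal_solvable minM sMG solG.
have tM := abelem_pgroup abM; have [_ t_dv _] := pgroup_pdiv tM ntM.
exists t; split=> //; first exact: dvdn_trans t_dv (cardSg sMG).
case/mingroupp/andP: minM => _ nMG.
apply: contraNneq ntM => O1; rewrite -subG1 -O1.
by apply: pcore_max; rewrite /normal ?sMG.
Qed.

Lemma Hall_pdvd (pi : nat_pred) G H t :
  pi.-Hall(G) H -> prime t -> t \in pi -> t %| #|G| -> t %| #|H|.
Proof.
move=> hallH t_pr pi_t t_dv; rewrite (card_Hall hallH).
have : t \in \pi(partn #|G| pi).
  by rewrite pi_of_part // inE /= pi_t mem_primes t_pr cardG_gt0 t_dv.
by rewrite mem_primes => /and3P[].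
Qed.

(** A Hall {q, r}-subgroup H has some O_t(H) != 1 with t = q or t = r. It plays the role of M in
    [frobenius_adj], and an element of H of the other prime order plays that of x. *)
Lemma sol_three_primes_normal G p q r V :
    solvable G -> prime p -> prime q -> prime r -> p != q -> q != r -> p != r ->
    q %| #|G| -> r %| #|G| -> V <| G -> p.-group V -> V :!=: 1 ->
  [|| adj G p q, adj G q r | adj G p r].
Proof.
move=> solG p_pr q_pr r_pr npq nqr npr q_dv r_dv /andP[sVG nVG] pV ntV.
have [H hallH] := Hall_exists [pred t | (t == q) || (t == r)] solG.
have sHG := pHall_sub hallH.
have qH : q %| #|H| by apply: (Hall_pdvd hallH) => //; rewrite inE /= eqxx ?orbT.
have rH : r %| #|H| by apply: (Hall_pdvd hallH) => //; rewrite inE /= eqxx ?orbT.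
have ntH : H :!=: 1.
  by apply: contraTneq qH => ->; rewrite cards1 dvdn1 neq_ltn prime_gt1 ?orbT.
have solH := solvableS sHG solG.
have [t [t_pr t_dv ntO]] := sol_pcore_neq1 solH ntH.
have nVH := subset_trans sHG nVG.
have sOH : 'O_t(H) \subset H := pcore_sub _ _.
have nOH : H \subset 'N('O_t(H)) by apply: gFnorm.
have main q' r' : prime q' -> prime r' -> p != q' -> q' != r' -> p != r' ->
    r' %| #|H| -> t = q' -> [|| adj G p q', adj G q' r' | adj G p r'].
  move=> q'_pr r'_pr npq' nqr' npr' r'_dv def_t; rewrite -{}def_t in q'_pr npq' nqr' *.
  have [x Hx ox] := Cauchy r'_pr r'_dv.
  apply: (@frobenius_adj G p t r' V 'O_t(H)%G x) => //.
  - exact: subset_trans sOH sHG.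
  - exact: (subsetP sHG).
  - exact: pcore_pgroup.
  - exact: subset_trans sOH nVH.
  - exact: (subsetP nVH).
  - exact: (subsetP nOH).
have : t \in [pred t | (t == q) || (t == r)].
  by apply: pnatPpi (pHall_pgroup hallH) _; rewrite mem_primes t_pr cardG_gt0.
rewrite inE /= => /orP[]/eqP def_t; first exact: main.
have := main r q r_pr q_pr npr; rewrite eq_sym nqr => /(_ isT npq qH def_t).
by rewrite (adjC _ r q); case/or3P=> ->; rewrite ?orbT.
Qed.

(** In a Hall {p, q, r}-subgroup H some O_t(H) is the normal subgroup required by the previous
    lemma; the three choices of t are alike up to symmetry of [adj]. *)
Lemma sol_three_primes G p q r :
    solvable G -> prime p -> prime q -> prime r -> p != q -> q != r -> p != r ->
    p %| #|G| -> q %| #|G| -> r %| #|G| ->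
  [|| adj G p q, adj G q r | adj G p r].
Proof.
move=> solG p_pr q_pr r_pr npq nqr npr p_dv q_dv r_dv.
have [H hallH] := Hall_exists [pred t | [|| t == p, t == q | t == r]] solG.
have sHG := pHall_sub hallH.
have pH : p %| #|H| by apply: (Hall_pdvd hallH) => //; rewrite inE /= eqxx ?orbT.
have qH : q %| #|H| by apply: (Hall_pdvd hallH) => //; rewrite inE /= eqxx ?orbT.
have rH : r %| #|H| by apply: (Hall_pdvd hallH) => //; rewrite inE /= eqxx ?orbT.
have ntH : H :!=: 1.
  by apply: contraTneq qH => ->; rewrite cards1 dvdn1 neq_ltn prime_gt1 ?orbT.
have solH := solvableS sHG solG.
have [t [t_pr t_dv ntO]] := sol_pcore_neq1 solH ntH.
have main p' q' r' : prime p' -> prime q' -> prime r' -> p' != q' -> q' != r' -> p' != r' ->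
    q' %| #|H| -> r' %| #|H| -> t = p' -> [|| adj G p' q', adj G q' r' | adj G p' r'].
  move=> p'_pr q'_pr r'_pr npq' nqr' npr' q'_dv r'_dv def_t; subst p'.
  have: [|| adj H t q', adj H q' r' | adj H t r'].
    apply: (@sol_three_primes_normal H t q' r' 'O_t(H)%G) => //.
      exact: pcore_normal.
    exact: pcore_pgroup.
  by case/or3P=> /(adj_sub sHG) ->; rewrite ?orbT.
have : t \in [pred t | [|| t == p, t == q | t == r]].
  by apply: pnatPpi (pHall_pgroup hallH) _; rewrite mem_primes t_pr cardG_gt0.
rewrite inE /= => /or3P[]/eqP def_t; first exact: main.
  have := main q p r q_pr p_pr r_pr; rewrite eq_sym npq => /(_ isT npr nqr pH rH def_t).
  by rewrite (adjC _ q p); case/or3P=> ->; rewrite ?orbT.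
have := main r p q r_pr p_pr q_pr; rewrite eq_sym npr => /(_ isT npq).
rewrite eq_sym nqr => /(_ isT pH qH def_t).
by rewrite (adjC _ r p) (adjC _ r q); case/or3P=> ->; rewrite ?orbT.
Qed.

End Solvable.

(** * Arrows between nonadjacent primes *)

Section Arrows.
Variable gT : finGroupType.
Implicit Types (G H K L M P Q R V : {group gT}) (p q r s t : nat).

Definition arrow G p q :=
  [exists P : {group gT}, exists V : {group gT},
     [&& p.-Sylow(G) P, q.-group V, V :!=: 1, V \subset G & P \subset 'N(V)]].

Lemma arrowP G p q :
  reflect (exists P V, [/\ p.-Sylow(G) P, q.-group V, V :!=: 1, V \subset G
                         & P \subset 'N(V)]) (arrow G p q).
Proof.
apply: (iffP existsP) => [[P /existsP[V /and5P[]]]|[P [V []]]].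
  by exists P, V; split.
by move=> sylP qV ntV sVG nVP; exists P; apply/existsP; exists V; apply/and5P.
Qed.

(** In a Hall {p, q}-subgroup H some O_t(H) is nontrivial, and it is normalized by the Sylow
    subgroups of H for the other prime, which are Sylow in G. *)
Lemma sol_arrow_total G p q :
    solvable G -> prime p -> prime q -> p != q -> p %| #|G| ->
  arrow G p q || arrow G q p.
Proof.
move=> solG p_pr q_pr npq p_dv.
have [H hallH] := Hall_exists [pred t | (t == p) || (t == q)] solG.
have sHG := pHall_sub hallH.
have pH : p %| #|H| by apply: (Hall_pdvd hallH) => //; rewrite inE /= eqxx.
have ntH : H :!=: 1.
  by apply: contraTneq pH => ->; rewrite cards1 dvdn1 neq_ltn prime_gt1 ?orbT.
have [t [t_pr t_dv ntO]] := sol_pcore_neq1 (solvableS sHG solG) ntH.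
have main s : s \in [pred t | (t == p) || (t == q)] -> arrow G s t.
  move=> s_in; have [P sylP] := Sylow_exists s H.
  apply/arrowP; exists P, 'O_t(H)%G; split=> //.
  - exact: subHall_Sylow hallH s_in sylP.
  - exact: pcore_pgroup.
  - exact: subset_trans (pcore_sub _ _) sHG.
  - exact: subset_trans (pHall_sub sylP) (gFnorm _ _).
have : t \in [pred t | (t == p) || (t == q)].
  by apply: pnatPpi (pHall_pgroup hallH) _; rewrite mem_primes t_pr cardG_gt0.
rewrite inE /= => /orP[]/eqP def_t; rewrite -{}def_t in main *.
  by rewrite (main q) ?orbT // inE /= eqxx orbT.
by rewrite (main p) // inE /= eqxx.
Qed.

Lemma arrow_Sylow G p q P : arrow G p q -> p.-Sylow(G) P ->
  exists V, [/\ q.-group V, V :!=: 1, V \subset G & P \subset 'N(V)].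
Proof.
case/arrowP=> P0 [V [sylP0 qV ntV sVG nVP0]] sylP.
have [x Gx ->] := Sylow_trans sylP0 sylP.
exists (V :^ x)%G; split; rewrite ?pgroupJ ?normJ ?conjSg //=.
  by rewrite -subG1 -(conjs1g x) conjSg subG1.
by rewrite conj_subG.
Qed.

Lemma arrow_rank1 G p q P : prime p -> prime q -> p != q -> ~~ adj G p q ->
    arrow G p q -> p.-Sylow(G) P ->
  cyclic P || (p == 2) && (extremal_class P == Quaternion).
Proof.
move=> p_pr q_pr npq nadj arr sylP.
have [V [qV ntV sVG nVP]] := arrow_Sylow arr sylP.
exact: rank1_of_nonadj nadj (pHall_sub sylP) sVG (pHall_pgroup sylP) qV ntV nVP.
Qed.

(* An automorphism fixes the unique involution of a cyclic or quaternion group. *)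
Lemma arrow_rank1_odd G p q Q : prime p -> prime q -> p != q -> ~~ adj G p q ->
    p %| #|G| -> arrow G p q -> q.-Sylow(G) Q ->
    cyclic Q || (q == 2) && (extremal_class Q == Quaternion) ->
  q != 2.
Proof.
move=> p_pr q_pr npq nadj p_dv /arrowP[P [V [sylP qV ntV sVG nVP]]] sylQ rkQ.
apply/eqP=> q2.
have qQ := pHall_pgroup sylQ.
have [x Gx sVQx] := Sylow_Jsub sylQ sVG qV.
pose U := (V :^ x)%G.
have ntU : U :!=: 1 by rewrite -subG1 /= -(conjs1g x) conjSg subG1.
have ntQ : Q :!=: 1 by apply: contraNneq ntU => Q1; rewrite -subG1 -Q1.
have oQ1 : #|'Ohm_1(Q)| = q by apply/(prime_Ohm1P qQ ntQ).
have qU : q.-group U by rewrite pgroupJ.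
have oU1 : #|'Ohm_1(U)| <= 2.
  by rewrite -q2 -oQ1 subset_leq_card // OhmS.
have oV1 : #|'Ohm_1(V)| <= 2 by rewrite -(cardJg _ x) -OhmJ.
have ntV1 : 'Ohm_1(V) != 1 by rewrite Ohm1_eq1.
have nV1P : P \subset 'N('Ohm_1(V)) by apply: char_norm_trans (Ohm_char 1 V) nVP.
have p_dvP : p %| #|P|.
  by apply: (Hall_pdvd sylP) => //; rewrite !inE.
have [y Py oy] := Cauchy p_pr p_dvP.
have sV1G : 'Ohm_1(V) \subset G := subset_trans (Ohm_sub 1 V) sVG.
have qV1 : q.-group 'Ohm_1(V) := pgroupS (Ohm_sub 1 V) qV.
have Gy : y \in G := subsetP (pHall_sub sylP) y Py.
have := cent1_pgroup_trivial p_pr q_pr npq nadj sV1G qV1 Gy oy.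
have [z V1z ntz] := trivgPn _ ntV1.
have V1_z u : u \in 'Ohm_1(V) -> u != 1 -> u = z.
  move=> V1u ntu; apply/eqP; apply: contraTT oV1 => nuz.
  rewrite -ltnNge; apply: leq_trans (subset_leq_card (_ : [set 1; u; z] \subset _)).
    by rewrite -setUA !cardsU1 cards1 !inE !(eq_sym 1) (negPf ntu) (negPf ntz) (negPf nuz).
  by apply/subsetP=> t; rewrite !inE => /orP[/orP[]|] /eqP->; rewrite ?group1.
move=> C1; case/negP: (ntz); apply/eqP/set1gP; rewrite -C1 inE V1z /=.
apply/cent1P; apply/commgP/conjg_fixP; apply: V1_z; last by rewrite conjg_eq1.
by rewrite memJ_norm // (subsetP nV1P).
Qed.

(** K acts on C through Aut(C), which is abelian. *)
Lemma cyclic_der1_cent (C K : {group gT}) :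
  cyclic C -> K \subset 'N(C) -> K^`(1) \subset 'C(C).
Proof.
move=> cycC nCK; rewrite -ker_conj_aut.
have : (conj_aut C @* K)^`(1) = 1.
  by apply/derG1P; apply: abelianS (Aut_conj_aut C K) (Aut_cyclic_abelian cycC).
rewrite -morphim_der // => /trivgP; rewrite -sub_morphim_pre //.
exact: subset_trans (der_sub 1 K) nCK.
Qed.

(** Descent along the derived series: if L^(n+1) is abelian it lies in F(L), so it is central; then
    L^(n) has class at most 2, lies in F(L) too, and is central as well. *)
Lemma sol_central_Fitting_abelian L : solvable L -> 'F(L) \subset 'C(L) -> abelian L.
Proof.
move=> solL cLF.
have step n : abelian L^`(n.+1) -> abelian L^`(n).
  move=> abLn1; have sub_cent M : M <| L -> nilpotent M -> M \subset 'C(L).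
    by move=> nsML nilM; apply: subset_trans cLF; apply: Fitting_max.
  have cLn1 : L^`(n.+1) \subset 'C(L).
    by apply: sub_cent; [apply: der_normal | apply: abelian_nil].
  have nilLn : nilpotent L^`(n).
    (* [nil_class] is defined for every group, nilpotent or not; a value at most 5 already forces
       nilpotency. *)
    apply: small_nil_class; apply: leq_trans (_ : 2 <= 5) => //.
    rewrite nil_class2 subsetI der_sub; apply: subset_trans cLn1 _.
    by rewrite centS // der_sub.
  have cLn := sub_cent _ (der_normal n L) nilLn.
  by rewrite /abelian (subset_trans cLn) // centS // der_sub.
have /derivedP[n Ln1] := solL.
have : abelian L^`(n) by rewrite Ln1 abelian1.
by elim: n {Ln1} => // n IHn /step.
Qed.

(** F(K) is a nilpotent Z-group, hence cyclic, so K' centralizes it. As F(K') lies in F(K), it is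
    central in K'. *)
Lemma Zgroup_der1_abelian K : solvable K -> Zgroup K -> abelian K^`(1).
Proof.
move=> solK ZK.
have cycF : cyclic 'F(K).
  exact: nil_Zgroup_cyclic (ZgroupS (Fitting_sub K) ZK) (Fitting_nil K).
apply: sol_central_Fitting_abelian; first exact: solvableS (der_sub 1 K) solK.
have sFF : 'F(K^`(1)) \subset 'F(K).
  apply: Fitting_max (Fitting_nil _).
  exact: char_normal_trans (Fitting_char _) (der_normal 1 K).
apply: subset_trans sFF _; rewrite centsC.
by rewrite cyclic_der1_cent // gFnorm.
Qed.

(** A conjugate of K contains P and V, so its derived subgroup contains the q-group [V, P]. This is
    nontrivial because no element of order p centralizes V. *)
Lemma der1_dvd (pi : nat_pred) G K p q :
    solvable G -> pi.-Hall(G) K ->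
    prime p -> prime q -> p != q -> ~~ adj G p q -> p %| #|G| ->
    p \in pi -> q \in pi -> arrow G p q -> q %| #|K^`(1)|.
Proof.
move=> solG hallK p_pr q_pr npq nadj p_dv pi_p pi_q.
case/arrowP=> P [V [sylP qV ntV sVG nVP]].
have sPG := pHall_sub sylP.
have piPV : pi.-group (P <*> V).
  rewrite (norm_joinEl nVP) pgroupM; apply/andP; split.
    by apply: sub_in_pnat (pHall_pgroup sylP) => t _ /eqnP->.
  by apply: sub_in_pnat qV => t _ /eqnP->.
have sPVG : P <*> V \subset G by rewrite join_subG sPG.
have [x Gx sPVKx] := Hall_subJ solG hallK sPVG piPV.
have sRV : [~: V, P] \subset V by rewrite commg_subl.
have sRKx : [~: V, P] \subset K^`(1) :^ x.
  rewrite -derJ; apply: commgSS; apply: subset_trans sPVKx.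
    exact: joing_subr.
  exact: joing_subl.
have ntR : [~: V, P] != 1.
  apply/eqP => /commG1P cVP.
  have [|y Py oy] := @Cauchy _ p P p_pr.
    by apply: (Hall_pdvd sylP) => //; rewrite !inE.
  case/negP: ntV; rewrite -subG1.
  rewrite -(cent1_pgroup_trivial p_pr q_pr npq nadj sVG qV (subsetP sPG y Py) oy).
  rewrite subsetI subxx sub_cent1.
  by apply: (subsetP _ y Py); rewrite centsC.
have [_ q_dv _] := pgroup_pdiv (pgroupS sRV qV) ntR.
by rewrite -(cardJg _ x); apply: dvdn_trans q_dv (cardSg sRKx).
Qed.

Lemma sol_no_arrow_walk G p q r s : solvable G ->
    prime p -> prime q -> prime r -> prime s ->
    p %| #|G| -> q %| #|G| -> r %| #|G| ->
    [&& p != q, ~~ adj G p q & arrow G p q] ->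
    [&& q != r, ~~ adj G q r & arrow G q r] ->
    [&& r != s, ~~ adj G r s & arrow G r s] -> False.
Proof.
move=> solG p_pr q_pr r_pr s_pr p_dv q_dv r_dv.
case/and3P=> npq nadjpq arrpq /and3P[nqr nadjqr arrqr] /and3P[nrs nadjrs arrrs].
(* An outgoing arrow leaves only the cyclic and quaternion cases; an incoming one excludes the prime
   2, hence the quaternion case. *)
have cycR R : r.-Sylow(G) R -> cyclic R.
  move=> sylR; have rkR := arrow_rank1 r_pr s_pr nrs nadjrs arrrs sylR.
  have := arrow_rank1_odd q_pr r_pr nqr nadjqr q_dv arrqr sylR rkR.
  by case/orP: rkR => // /andP[->].
have cycQ Q : q.-Sylow(G) Q -> cyclic Q.
  move=> sylQ; have rkQ := arrow_rank1 q_pr r_pr nqr nadjqr arrqr sylQ.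
  have := arrow_rank1_odd p_pr q_pr npq nadjpq p_dv arrpq sylQ rkQ.
  by case/orP: rkQ => // /andP[->].
(* No arrow enters p, so another argument is used: P acts faithfully on a cyclic q-group V, hence P'
   = 1. *)
have cycP P : p.-Sylow(G) P -> cyclic P.
  move=> sylP; have rkP := arrow_rank1 p_pr q_pr npq nadjpq arrpq sylP.
  have [V [qV ntV sVG nVP]] := arrow_Sylow arrpq sylP.
  have cycV : cyclic V.
    have [Q sylQ sVQ] := Sylow_superset sVG qV.
    exact: cyclicS sVQ (cycQ Q sylQ).
  have CPV : 'C_P(V) = 1.
    apply/eqP/idPn => ntC.
    have pC : p.-group 'C_P(V) by apply: pgroupS (pHall_pgroup sylP); apply: subsetIl.
    have [y /setIP[Py cVy] oy] := pgroup_order_prime pC ntC.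
    case/negP: ntV; rewrite -subG1.
    have Gy := subsetP (pHall_sub sylP) y Py.
    rewrite -(cent1_pgroup_trivial p_pr q_pr npq nadjpq sVG qV Gy oy).
    by rewrite subsetI subxx sub_cent1.
  have abP : abelian P.
    apply/derG1P/trivgP; rewrite -CPV subsetI der_sub.
    exact: cyclic_der1_cent.
  (* A quaternion group of order 2 ^ n has derived subgroup of order 2 ^ n.-2, which is not 1 as n >
     2. *)
  case/orP: rkP => // /andP[/eqP p2 /eqP/quaternion_classP[n n_gt2 isoP]].
  have [[x y]] := generators_quaternion n_gt2 isoP => genP _.
  have [_ [_ _ oP' _] _ _ _] := quaternion_structure n_gt2 genP isoP.
  move: oP'; rewrite (derG1P abP) cards1.
  by case: n n_gt2 {isoP genP} => [|[|[|n]]] //= _; rewrite expnS => /esym/eqP;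
    rewrite muln_eq1.
pose pi : nat_pred := [pred t | [|| t == p, t == q | t == r]].
have [K hallK] := Hall_exists pi solG.
have ZK : Zgroup K.
  apply/forall_inP=> S /SylowP[t t_pr sylS].
  have [t_pi | not_t_pi] := boolP (t \in pi).
    have sylGS := subHall_Sylow hallK t_pi sylS.
    by case/or3P: t_pi sylGS => /eqP-> ; [apply: cycP | apply: cycQ | apply: cycR].
  have [->|ntS] := eqsVneq S 1; first exact: cyclic1.
  have [_ t_dv _] := pgroup_pdiv (pHall_pgroup sylS) ntS.
  case/negP: not_t_pi; apply: pnatPpi (pHall_pgroup hallK) _.
  by rewrite mem_primes t_pr cardG_gt0 (dvdn_trans t_dv) ?cardSg ?(pHall_sub sylS).
have abK' := Zgroup_der1_abelian (solvableS (pHall_sub hallK) solG) ZK.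
have qK' : q %| #|K^`(1)|.
  by apply: (@der1_dvd pi G K p q) => //; rewrite inE /= eqxx ?orbT.
have rK' : r %| #|K^`(1)|.
  by apply: (@der1_dvd pi G K q r) => //; rewrite inE /= eqxx ?orbT.
have [x K'x ox] := Cauchy q_pr qK'; have [y K'y oy] := Cauchy r_pr rK'.
case/negP: nadjqr; have sK'G := subset_trans (der_sub 1 K) (pHall_sub hallK).
apply: (@adj_commute _ G q r x y); rewrite ?ox ?oy ?(subsetP sK'G) //.
exact: (centsP abK').
Qed.

End Arrows.

(* The color of [p] is the length, capped at 2, of the longest walk of arrows   *)
(* between nonadjacent primes that leaves [p].                                  *)
Lemma sol_coloring (gT : finGroupType) (G : {group gT}) : solvable G ->
  exists c : nat -> 'I_3, forall p q, prime p -> prime q -> p != q ->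
    p %| #|G| -> q %| #|G| -> ~~ adj G p q -> c p != c q.
Proof.
move=> solG.
pose E p q := [&& p != q, ~~ adj G p q & arrow G p q].
pose out1 p := has (E p) (primes #|G|).
pose out2 p := has (fun q => E p q && out1 q) (primes #|G|).
exists (fun p => if out2 p then inord 2 else if out1 p then inord 1 else ord0).
have primesG p : (p \in primes #|G|) = prime p && (p %| #|G|).
  by rewrite mem_primes cardG_gt0.
have main p q : prime p -> prime q -> p %| #|G| -> q %| #|G| -> E p q ->
    [/\ out1 p, ~~ out2 q & out1 q -> out2 p].
  move=> p_pr q_pr p_dv q_dv Epq; split.
  - by apply/hasP; exists q => //; rewrite primesG q_pr.
  - apply/hasPn => r; rewrite primesG => /andP[r_pr r_dv].
    apply/negP=> /andP[Eqr /hasP[s]]; rewrite primesG => /andP[s_pr s_dv] Ers.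
    exact: (sol_no_arrow_walk solG p_pr q_pr r_pr s_pr p_dv q_dv r_dv Epq Eqr Ers).
  - by move=> o1q; apply/hasP; exists q; rewrite ?Epq // primesG q_pr.
move=> p q p_pr q_pr npq p_dv q_dv nadj.
have val2 : val (inord 2 : 'I_3) = 2 by rewrite /= inordK.
have val1 : val (inord 1 : 'I_3) = 1%N by rewrite /= inordK.
wlog Epq : p q p_pr q_pr npq p_dv q_dv nadj / E p q.
  move=> IH; case/orP: (sol_arrow_total solG p_pr q_pr npq p_dv) => arr.
    by apply: IH => //; apply/and3P.
  by rewrite eq_sym; apply: IH; rewrite 1?eq_sym 1?adjC // /E 1?eq_sym 1?adjC; apply/and3P.
(* Along an arrow p -> q the color drops: q has color 0 or 1, and p has color 2 if q has color 1,
   and color 1 or 2 otherwise. *)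
have [-> /negPf-> o12] := main p q p_pr q_pr p_dv q_dv Epq.
case: (out1 q) o12 => [->//|_].
  by apply/eqP => /(congr1 val); rewrite val1 val2.
by case: ifP => _; apply/eqP => /(congr1 val); rewrite ?val1 ?val2.
Qed.

(** * The group SL(3,3) *)

Section MatrixThree.
Import GRing.Theory.
Local Open Scope ring_scope.

Definition M3 (R : nzRingType) (a b c d e f g h i : R) : 'M[R]_3 :=
  \matrix_(k, l) nth 0 (nth [::] [:: [:: a; b; c]; [:: d; e; f]; [:: g; h; i]] k) l.

Lemma M3_mul (R : nzRingType) (a b c d e f g h i a' b' c' d' e' f' g' h' i' : R) :
  M3 a b c d e f g h i *m M3 a' b' c' d' e' f' g' h' i' =
  M3 (a * a' + b * d' + c * g') (a * b' + b * e' + c * h') (a * c' + b * f' + c * i')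
     (d * a' + e * d' + f * g') (d * b' + e * e' + f * h') (d * c' + e * f' + f * i')
     (g * a' + h * d' + i * g') (g * b' + h * e' + i * h') (g * c' + h * f' + i * i').
Proof.
apply/matrixP=> -[[|[|[|//]]] ?] [[|[|[|//]]] ?];
by rewrite !mxE !big_ord_recl big_ord0 !mxE /= addr0 addrA.
Qed.

Lemma M3_1 (R : nzRingType) : M3 1 0 0 0 1 0 0 0 1 = 1%:M :> 'M[R]_3.
Proof. by apply/matrixP=> -[[|[|[|//]]] ?] [[|[|[|//]]] ?]; rewrite !mxE. Qed.

Lemma det_M3 (R : comNzRingType) (a b c d e f g h i : R) :
  \det (M3 a b c d e f g h i) =
  a * (e * i - f * h) - b * (d * i - f * g) + c * (d * h - e * g).
Proof.
have det2 (A : 'M[R]_2) : \det A = A 0 0 * A 1 1 - A 0 1 * A 1 0.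
  rewrite (expand_det_row _ ord0) !big_ord_recl big_ord0 /cofactor !det_mx11 !mxE /=.
  rewrite expr0 expr1 mul1r mulN1r mulrN addr0.
  by congr (A _ _ * A _ _ - A _ _ * A _ _); apply: val_inj.
rewrite (expand_det_row _ ord0) !big_ord_recl big_ord0 /cofactor !det2 !mxE /=.
rewrite /bump /= expr0 expr1 mul1r mulN1r mulrN addr0 sqrrN expr1n mul1r addrA.
by [].
Qed.

End MatrixThree.

(** X and Y generate an elementary abelian group of order 9, U commutes with the involution S, I and
    J generate a quaternion group with square S, and S and T generate a four-group. *)
Local Notation eltX := (M3 1 0 1 0 1 0 0 0 (1 : 'F_3))%R.
Local Notation eltY := (M3 1 0 0 0 1 1 0 0 (1 : 'F_3))%R.
Local Notation eltU := (M3 1 1 0 0 1 0 0 0 (1 : 'F_3))%R.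
Local Notation eltS := (M3 (-1) 0 0 0 (-1) 0 0 0 (1 : 'F_3))%R.
Local Notation eltT := (M3 1 0 0 0 (-1) 0 0 0 (-1 : 'F_3))%R.
Local Notation eltI := (M3 0 (-1) 0 1 0 0 0 0 (1 : 'F_3))%R.
Local Notation eltJ := (M3 1 1 0 1 (-1) 0 0 0 (1 : 'F_3))%R.

Section SL33.
Import GRing.Theory.
Local Open Scope ring_scope.

Local Notation F := 'F_3.
Local Notation GL3 := {'GL_3[F]}.
Definition SL33 := SLgroup_group 3 F.

(* Locked, because comparing two unlocked instances evaluates determinants. *)
Fact mkSL_key : unit. Proof. by []. Qed.
Definition mkSL (A : 'M[F]_3) : GL3 := locked_with mkSL_key (insubd (1%g : GL3) A).

Lemma mkSLK A : \det A = 1 -> GLval (mkSL A) = A.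
Proof.
move=> dA; rewrite /mkSL unlock; apply: insubdK.
by rewrite unfold_in /= -[_ \is a _]/(A \in unitmx) unitmxE dA unitr1.
Qed.

Lemma GL3_inj : injective (@GLval 3 F).
Proof. exact: val_inj. Qed.

Lemma mkSL_in A : \det A = 1 -> mkSL A \in SL33.
Proof. by move=> dA; rewrite inE mkSLK ?dA. Qed.

Lemma mkSL_mul A B : \det A = 1 -> \det B = 1 -> (mkSL A * mkSL B)%g = mkSL (A *m B).
Proof.
by move=> dA dB; apply: GL3_inj; rewrite GL_MxE !mkSLK // det_mulmx dA dB mulr1.
Qed.

Lemma mkSL1 : mkSL 1%:M = 1%g.
Proof. by apply: GL3_inj; rewrite mkSLK ?det1. Qed.

Lemma mkSL_inj A B : \det A = 1 -> \det B = 1 -> mkSL A = mkSL B -> A = B.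
Proof. by move=> dA dB /(congr1 GLval); rewrite !mkSLK. Qed.


Ltac det3 := rewrite /= det_M3; exact/eqP.

Lemma detX : \det eltX = 1. Proof. det3. Qed.
Lemma detY : \det eltY = 1. Proof. det3. Qed.
Lemma detU : \det eltU = 1. Proof. det3. Qed.
Lemma detS : \det eltS = 1. Proof. det3. Qed.
Lemma detT : \det eltT = 1. Proof. det3. Qed.
Lemma detI : \det eltI = 1. Proof. det3. Qed.
Lemma detJ : \det eltJ = 1. Proof. det3. Qed.


Lemma mkSL_commute A B :
  \det A = 1 -> \det B = 1 -> A *m B = B *m A -> commute (mkSL A) (mkSL B).
Proof.
move=> dA dB cAB.
exact: (etrans (mkSL_mul dA dB) (etrans (congr1 mkSL cAB) (esym (mkSL_mul dB dA)))).
Qed.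

Lemma mkSL_order A p : prime p -> \det A = 1 -> A != 1%:M ->
  (mkSL A ^+ p = 1)%g -> #[mkSL A]%g = p.
Proof.
move=> p_pr dA ntA Ap1; apply: nt_prime_order => //.
by apply: contra ntA => /eqP; rewrite -mkSL1 => /mkSL_inj->; rewrite ?det1.
Qed.

Lemma mkSL_order2 A : \det A = 1 -> A != 1%:M -> A *m A = 1%:M -> #[mkSL A]%g = 2%N.
Proof. by move=> dA ntA A2; apply: mkSL_order => //; rewrite !expgS expg0 mulg1 mkSL_mul // A2 mkSL1. Qed.

Lemma mkSL_order3 A :
  \det A = 1 -> A != 1%:M -> A *m (A *m A) = 1%:M -> #[mkSL A]%g = 3%N.
Proof.
move=> dA ntA A3; apply: mkSL_order => //; rewrite !expgS expg0 mulg1.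
by rewrite [(mkSL A * mkSL A)%g]mkSL_mul // mkSL_mul ?det_mulmx ?dA ?mulr1 // A3 mkSL1.
Qed.

Lemma mkSL_ncommute A B : \det A = 1 -> \det B = 1 -> A *m B != B *m A ->
  (mkSL A * mkSL B)%g != (mkSL B * mkSL A)%g.
Proof.
move=> dA dB; apply: contra => /eqP eqAB; apply/eqP; apply: mkSL_inj.
- by rewrite det_mulmx dA dB mulr1.
- by rewrite det_mulmx dA dB mulr1.
exact: etrans (esym (mkSL_mul dA dB)) (etrans eqAB (mkSL_mul dB dA)).
Qed.

Lemma mkSL_sqr A B : \det A = 1 -> A *m A = B -> (mkSL A ^+ 2 = mkSL B)%g.
Proof. by move=> dA <-; rewrite !expgS expg0 mulg1 mkSL_mul. Qed.

Lemma mkSL_mul3 A B C : \det A = 1 -> \det B = 1 -> A *m B *m A = C ->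
  (mkSL A * mkSL B * mkSL A = mkSL C)%g.
Proof.
move=> dA dB <-; rewrite [X in (X * _)%g]mkSL_mul // mkSL_mul //.
by rewrite det_mulmx dA dB mulr1.
Qed.

Ltac calcM3 := rewrite -?(M3_1 F) ?M3_mul; congr M3; exact/eqP.
Ltac neqM3 i j := rewrite -?(M3_1 F); apply/eqP => /matrixP/(_ (inord i) (inord j));
  by rewrite !mxE !inordK //=; move/eqP.

Lemma commute_XY : commute (mkSL eltX) (mkSL eltY).
Proof. by apply: mkSL_commute detX detY _; calcM3. Qed.

Lemma commute_US : commute (mkSL eltU) (mkSL eltS).
Proof. by apply: mkSL_commute detU detS _; calcM3. Qed.

Lemma commute_ST : commute (mkSL eltS) (mkSL eltT).
Proof. by apply: mkSL_commute detS detT _; calcM3. Qed.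

Lemma orderX : #[mkSL eltX]%g = 3%N.
Proof. by apply: (mkSL_order3 detX); [neqM3 0%N 2%N | calcM3]. Qed.

Lemma orderY : #[mkSL eltY]%g = 3%N.
Proof. by apply: (mkSL_order3 detY); [neqM3 1%N 2%N | calcM3]. Qed.

Lemma orderU : #[mkSL eltU]%g = 3%N.
Proof. by apply: (mkSL_order3 detU); [neqM3 0%N 1%N | calcM3]. Qed.

Lemma orderS : #[mkSL eltS]%g = 2%N.
Proof. by apply: (mkSL_order2 detS); [neqM3 0%N 0%N | calcM3]. Qed.

Lemma orderT : #[mkSL eltT]%g = 2%N.
Proof. by apply: (mkSL_order2 detT); [neqM3 1%N 1%N | calcM3]. Qed.

Lemma neqST : mkSL eltS != mkSL eltT.
Proof.
suff neq : eltS != eltT by apply: contra neq => /eqP/(mkSL_inj detS detT)/eqP.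
neqM3 0%N 0%N.
Qed.

Lemma sqrI : (mkSL eltI ^+ 2 = mkSL eltS)%g.
Proof. by apply: (mkSL_sqr detI); calcM3. Qed.

Lemma sqrJ : (mkSL eltJ ^+ 2 = mkSL eltS)%g.
Proof. by apply: (mkSL_sqr detJ); calcM3. Qed.

Lemma ncommuteIJ : (mkSL eltI * mkSL eltJ)%g != (mkSL eltJ * mkSL eltI)%g.
Proof. by apply: (mkSL_ncommute detI detJ); rewrite !M3_mul; neqM3 0%N 0%N. Qed.

Lemma conjIJ : (mkSL eltI * mkSL eltJ * mkSL eltI)%g = mkSL eltJ.
Proof. by apply: (mkSL_mul3 detI detJ); calcM3. Qed.

(** U centralizes X but not Y. *)
Lemma notinXY : mkSL eltY \notin <[mkSL eltX]>%g.
Proof.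
have cUX : commute (mkSL eltU) (mkSL eltX).
  by apply: mkSL_commute detU detX _; calcM3.
have ncUY : (mkSL eltU * mkSL eltY)%g != (mkSL eltY * mkSL eltU)%g.
  by apply: (mkSL_ncommute detU detY); rewrite !M3_mul; neqM3 0%N 2%N.
by apply: contra ncUY => /cycleP[i ->]; apply/eqP/commuteX.
Qed.

Lemma SL33_elements3 : exists x y : GL3,
  [/\ x \in SL33, y \in SL33, #[x]%g = 3%N, #[y]%g = 3%N
    & commute x y /\ y \notin <[x]>%g].
Proof.
exists (mkSL eltX), (mkSL eltY); split; rewrite ?orderX ?orderY //.
- exact: mkSL_in detX.
- exact: mkSL_in detY.
- by split; [exact: commute_XY | exact: notinXY].
Qed.

Lemma SL33_elements6 : exists u s : GL3,
  [/\ u \in SL33, s \in SL33, #[u]%g = 3%N, #[s]%g = 2%N & commute u s].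
Proof.
exists (mkSL eltU), (mkSL eltS); split.
- exact: mkSL_in detU.
- exact: mkSL_in detS.
- exact: orderU.
- exact: orderS.
- exact: commute_US.
Qed.

(* [i] and [j] generate a quaternion group, [s] and [t] a four-group. *)
Lemma SL33_elements2 : exists i j s t : GL3,
  [/\ [/\ i \in SL33, j \in SL33, s \in SL33 & t \in SL33],
      [/\ (i ^+ 2 = s)%g, (j ^+ 2 = s)%g, (i * j * i = j)%g & ~ commute i j]
    & [/\ #[s]%g = 2%N, #[t]%g = 2%N, commute s t & s != t]].
Proof.
exists (mkSL eltI), (mkSL eltJ), (mkSL eltS), (mkSL eltT); split; split.
- exact: mkSL_in detI.
- exact: mkSL_in detJ.
- exact: mkSL_in detS.
- exact: mkSL_in detT.
- exact: sqrI.
- exact: sqrJ.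
- exact: conjIJ.
- exact/eqP/ncommuteIJ.
- exact: orderS.
- exact: orderT.
- exact: commute_ST.
- exact: neqST.
Qed.

Lemma F3_card : #|'F_3| = 3%N. Proof. exact: card_Fp. Qed.

Lemma F3_neq0 (a : F) : a != 0 -> (a == 1) || (a == -1).
Proof. by case: a => -[|[|[|//]]]. Qed.

Lemma F3_cube (a : F) : a ^+ 3 = a.
Proof. by have := expf_card a; rewrite F3_card. Qed.

Lemma M3_eta (A : 'M[F]_3) :
  exists a b c d e f g h i, A = M3 a b c d e f g h i.
Proof.
pose x i j := A (inord i) (inord j).
exists (x 0 0)%N, (x 0 1)%N, (x 0 2)%N, (x 1 0)%N, (x 1 1)%N, (x 1 2)%N.
exists (x 2 0)%N, (x 2 1)%N, (x 2 2)%N.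
apply/matrixP=> -[[|[|[|//]]] lti] [[|[|[|//]]] ltj]; rewrite !mxE /=;
  by congr (A _ _); apply: val_inj; rewrite /= inordK.
Qed.

(** Commuting with the permutation matrix of a 3-cycle makes a matrix circulant, and commuting with
    U then makes it a scalar a. Its determinant a^3 equals a in F_3, so a = 1. *)
Lemma SL33_center : 'Z(SL33)%g = 1%g.
Proof.
apply/trivgP/subsetP=> u /centerP[SLu cSLu].
have cent B : \det B = 1 -> GLval u *m B = B *m GLval u.
  move=> dB; have /(congr1 GLval) := cSLu _ (mkSL_in dB).
  by rewrite !GL_MxE mkSLK.
have detC : \det (M3 0 1 0 0 0 1 1 0 0 : 'M[F]_3) = 1 by det3.
have := cent _ detU; have := cent _ detC.
have /eqP : u \in SLgroup 3 F by [].
rewrite inE => /eqP; have [a [b [c [d [e [f [g [h [i def_u]]]]]]]]] := M3_eta (GLval u).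
rewrite def_u !M3_mul det_M3 => detu /matrixP CC /matrixP CU.
have entry (A B : 'M[F]_3) (k l : nat) : A =2 B -> (k < 3)%N -> (l < 3)%N ->
    A (inord k) (inord l) = B (inord k) (inord l) by [].
have simp := (mulr1, mul1r, mulr0, mul0r, addr0, add0r).
have:= entry _ _ 0%N 0%N CU isT isT; rewrite !mxE !inordK //= !simp => /eqP.
rewrite -[X in X == _]addr0 (inj_eq (addrI a)) => /eqP d0.
have:= entry _ _ 0%N 2%N CU isT isT; rewrite !mxE !inordK //= !simp => /eqP.
rewrite -[X in X == _]addr0 (inj_eq (addrI c)) => /eqP f0.
have:= entry _ _ 0%N 0%N CC isT isT; rewrite !mxE !inordK //= !simp => cd.
have:= entry _ _ 0%N 1%N CC isT isT; rewrite !mxE !inordK //= !simp => ae.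
have:= entry _ _ 0%N 2%N CC isT isT; rewrite !mxE !inordK //= !simp => bf.
have:= entry _ _ 1%N 0%N CC isT isT; rewrite !mxE !inordK //= !simp => fg.
have:= entry _ _ 1%N 1%N CC isT isT; rewrite !mxE !inordK //= !simp => dh.
have:= entry _ _ 1%N 2%N CC isT isT; rewrite !mxE !inordK //= !simp => ei.
move: detu def_u; rewrite -ei -dh -fg bf cd -d0 -f0 -ae !simp !subr0.
rewrite -!expr2 -exprS F3_cube => /eqP-> def_u.
by apply/set1gP/GL3_inj; rewrite def_u M3_1 GL_1E.
Qed.

(** The scalar -1 has determinant -1 in dimension 3, so GL(3,3), of order 11232, is the disjoint
    union of two cosets of SL(3,3). *)
Lemma card_SL33 : #|SL33| = 5616%N.
Proof.
have oGL : #|'GL_3[F]| = (5616 * 2)%N.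
  rewrite card_GL // F3_card; do 3!rewrite big_ltn //.
  by rewrite big_geq //; apply/eqP; vm_compute.
have detN : \det (- 1%:M : 'M[F]_3) = -1.
  by rewrite -scaleN1r detZ det1 mulr1; apply/eqP.
have N1u : (- 1%:M : 'M[F]_3) \in unitmx by rewrite unitmxE detN unitrN1.
pose n1 : GL3 := FinRing.Unit N1u.
have GLvaln1 : GLval n1 = - 1%:M by [].
have defGL : 'GL_3[F] = SL33 :|: (n1 *: SL33)%g.
  apply/setP=> u; rewrite !inE mem_lcoset inE; apply/esym.
  have := F3_neq0 (GL_det u); case/orP => [->//| /eqP du].
  rewrite GL_ME det_mulmx du.
  have : GLval (n1 * n1^-1)%g = 1%:M by rewrite mulgV GL_1E.
  rewrite GL_MxE => /(congr1 determinant); rewrite det_mulmx GLvaln1 detN det1.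
  by rewrite mulrN1 mulN1r => ->; rewrite eqxx orbT.
apply/eqP; rewrite -(eqn_pmul2r (isT : 0 < 2)%N) -oGL defGL cardsU.
rewrite (_ : _ :&: _ = set0) ?cards0 ?subn0 ?card_lcoset ?muln2 ?addnn //.
apply/setP=> u; rewrite !inE mem_lcoset inE GL_ME det_mulmx.
apply/negbTE/negP=> /andP[/eqP-> ]; rewrite mulr1 => /eqP dn1.
have : GLval (n1 * n1^-1)%g = 1%:M by rewrite mulgV GL_1E.
by rewrite GL_MxE => /(congr1 determinant); rewrite det_mulmx GLvaln1 detN dn1 det1 => /eqP.
Qed.

Lemma PSL33_isog : PSL33 \isog SL33.
Proof.
rewrite isog_sym; apply: quotient_isog; first exact: normal_norm (center_normal _).
have Z1 : 'Z(SLgroup 3 F)%g = 1%g := SL33_center.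
apply/trivgP; apply: subset_trans (subsetIl _ _) _; apply/trivgP; exact: Z1.
Qed.

End SL33.

(** * Composition factors *)

Section Pseudo.
Variable gT : finGroupType.
Implicit Types (G H N K : {group gT}) (s : seq {group gT}).

Definition good_factor (rT : finGroupType) (K : {group rT}) :=
  abelian K || (K \isog PSL33).

Lemma good_factor_isog (aT rT : finGroupType) (A : {group aT}) (B : {group rT}) :
  A \isog B -> good_factor A = good_factor B.
Proof.
by move=> isoAB; rewrite /good_factor (isog_abelian isoAB) (isog_transl _ isoAB).
Qed.

(** By Jordan-Hoelder one composition series decides; [good_factor] is invariant under isomorphism,
    so it passes between sections and their representatives. *)
Lemma pseudoP G s : comps G s ->
  pseudo_PSL33_solvable G <->
    all (fun K : section gT => good_factor (section_group K)) (pairmap (@mkSec _) G s).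
Proof.
move=> cGs; split=> [psG | /allP goodG t cGt K].
  apply/allP=> K Ks; rewrite -(good_factor_isog (section_reprP K)).
  have H := psG s cGs (section_repr K) (map_f _ Ks). exact: H.
rewrite (perm_mem (JordanHolderUniqueness cGt cGs)) => /mapP[L /goodG goodL ->].
by have := goodL; rewrite -(good_factor_isog (section_reprP L)).
Qed.

Lemma comps_max G H s : maxnormal H G G -> comps H s -> comps G (H :: s).
Proof. by move=> maxH /andP[lHs cHs]; apply/and3P. Qed.

Lemma pseudo_max G H : maxnormal H G G -> pseudo_PSL33_solvable G <->
  good_factor (G / H)%G /\ pseudo_PSL33_solvable H.
Proof.
move=> maxH; have [s cHs] := exists_comps H.
have psGP := pseudoP (comps_max maxH cHs); have psHP := pseudoP cHs.
split=> [/psGP/= /andP[goodGH goods] | [goodGH /psHP goods]].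
  by split=> //; apply/psHP.
by apply/psGP/andP.
Qed.

Lemma maxnormal_above G N : N <| G -> N :!=: G ->
  exists2 H : {group gT}, maxnormal H G G & N \subset H.
Proof.
move=> /andP[sNG nNG] neNG.
have [|H maxH sNH] := @maxgroup_exists _ (fun K => (K \proper G) && (G \subset 'N(K))) N.
  by rewrite properEneq neNG sNG.
by exists H.
Qed.

Lemma pseudo_normal G N : N <| G -> pseudo_PSL33_solvable G -> pseudo_PSL33_solvable N.
Proof.
have [n] := ubnP #|G|; elim: n G => // n IHn G /ltnSE-leGn nsNG psG.
have [eqNG | neNG] := eqsVneq N G; first by rewrite (group_inj eqNG).
have [H maxH sNH] := maxnormal_above nsNG neNG.
apply: (IHn H).
- exact: leq_trans (proper_card (maxnormal_proper maxH)) leGn.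
- exact: normalS sNH (maxnormal_sub maxH) nsNG.
- by case/(pseudo_max maxH): psG.
Qed.

Lemma sol_pseudo G : solvable G -> pseudo_PSL33_solvable G.
Proof.
have [n] := ubnP #|G|; elim: n G => // n IHn G /ltnSE-leGn solG.
have [G1 | ntG] := eqsVneq G 1.
  have cG : comps G [::] by apply/andP; split=> //=; apply/eqP/val_inj.
  by apply/(pseudoP cG).
have [H maxH] := ex_maxnormal_ntrivg ntG.
apply/(pseudo_max maxH); split.
  have simGH : simple (G / H) by rewrite quotient_simple ?maxnormal_normal.
  have prGH := simple_sol_prime (quotient_sol H solG) simGH.
  by rewrite /good_factor cyclic_abelian ?prime_cyclic.
apply: IHn; last exact: solvableS (maxnormal_sub maxH) solG.
exact: leq_trans (proper_card (maxnormal_proper maxH)) leGn.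
Qed.

(** Descend through maximal normal subgroups to a nonsolvable group whose chosen maximal normal
    subgroup is solvable. The factor there cannot be abelian, so it is PSL(3,3), which is isomorphic
    to SL(3,3). *)
Lemma pseudo_homg_SL33 G : pseudo_PSL33_solvable G -> ~~ solvable G ->
  exists2 N : {group gT}, N \subset G & (SL33 \homg N).
Proof.
have [n] := ubnP #|G|; elim: n G => // n IHn G /ltnSE-leGn psG nsolG.
have ntG : G :!=: 1 by apply: contraNneq nsolG => ->; apply: solvable1.
have [H maxH] := ex_maxnormal_ntrivg ntG.
have [goodGH psH] := (pseudo_max maxH).1 psG.
have [solH | nsolH] := boolP (solvable H); last first.
  have [||//|N sNH homN] := IHn H.
  - exact: leq_trans (proper_card (maxnormal_proper maxH)) leGn.
  - by [].
  by exists N => //; apply: subset_trans (maxnormal_sub maxH).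
exists G => //; have nsHG := maxnormal_normal maxH.
case/orP: goodGH => [abGH | isoGH].
  by case/negP: nsolG; rewrite (series_sol nsHG) solH abelian_sol.
apply: homg_trans (quotient_homg (normal_norm nsHG)).
by apply: isog_hom; rewrite isog_sym (isog_trans isoGH) ?PSL33_isog.
Qed.

Lemma pseudo_simple G : simple G -> pseudo_PSL33_solvable G -> good_factor G.
Proof.
rewrite simple_maxnormal => max1 /(pseudo_max (H := 1%G) max1)[good1 _].
by rewrite (good_factor_isog (quotient1_isog G)).
Qed.

End Pseudo.

Lemma pseudo_quotient (gT : finGroupType) (G N : {group gT}) :
  N <| G -> pseudo_PSL33_solvable G -> pseudo_PSL33_solvable (G / N)%G.
Proof.
have [n] := ubnP #|G|; elim: n G => // n IHn G /ltnSE-leGn nsNG psG.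
have [eqNG | neNG] := eqsVneq N G.
  by apply: sol_pseudo; rewrite /= -eqNG trivg_quotient solvable1.
have [H maxH sNH] := maxnormal_above nsNG neNG.
have [goodGH psH] := (pseudo_max maxH).1 psG.
have nsHG := maxnormal_normal maxH.
have maxHN : maxnormal (H / N)%G (G / N)%G (G / N)%G.
  rewrite -quotient_simple ?quotient_normal //.
  rewrite (isog_simple (third_isog sNH nsNG nsHG)).
  by rewrite quotient_simple.
apply/(pseudo_max maxHN); split.
  by rewrite (good_factor_isog (third_isog sNH nsNG nsHG)).
apply: IHn => //.
  exact: leq_trans (proper_card (maxnormal_proper maxH)) leGn.
exact: normalS sNH (maxnormal_sub maxH) nsNG.
Qed.

(** * Sylow subgroups of SL(3,3) *)

Section SectionSL33.

Lemma pgroup_cycle (gT : finGroupType) p (x : gT) : prime p -> #[x] = p -> p.-group <[x]>.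
Proof. by move=> p_pr ox; rewrite /pgroup -orderE ox pnat_id. Qed.

(** A conjugate of S contains <x, y>, and a cyclic group has only one subgroup of order p. *)
Lemma Sylow_noncyclic (gT : finGroupType) p (L S : {group gT}) x y : prime p ->
    x \in L -> y \in L -> #[x] = p -> #[y] = p -> commute x y -> y \notin <[x]> ->
  p.-Sylow(L) S -> ~~ cyclic S.
Proof.
move=> p_pr SLx SLy ox oy cxy nxy sylS; apply/negP=> cycS.
pose Q := (<[x]> <*> <[y]>)%G.
have cXY : <[y]> \subset 'C(<[x]>) by apply: cents_cycle; apply: commute_sym.
have Qp : p.-group Q.
  by rewrite /= (cent_joinEr cXY) pgroupM !pgroup_cycle ?ox ?oy.
have sQSL : Q \subset L.
  by rewrite join_subG !cycle_subG SLx.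
have [u SLu sQSu] := Sylow_subJ sylS sQSL Qp.
have cycQ : cyclic Q by apply: cyclicS sQSu _; rewrite cyclicJ.
have : <[x]> :==: <[y]>.
  rewrite (eq_subG_cyclic cycQ) ?joing_subl ?joing_subr //.
  by rewrite -!orderE ox oy.
by move/eqP=> eqXY; case/negP: nxy; rewrite eqXY cycle_id.
Qed.

(** The 2-groups <i, j> and <s, t> are moved into S by separate conjugations, so the conclusion
    keeps no relation between the two pairs. *)
Lemma Sylow2_elements (gT : finGroupType) (L S : {group gT}) i j s t :
    [/\ i \in L, j \in L, s \in L & t \in L] ->
    [/\ i ^+ 2 = s, j ^+ 2 = s, i * j * i = j & ~ commute i j] ->
    [/\ #[s] = 2, #[t] = 2, commute s t & s != t] ->
    2.-Sylow(L) S -> exists a b s' t',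
  [/\ [/\ a \in S, b \in S, s' \in S & t' \in S],
      [/\ a ^+ 2 != 1, b ^+ 2 != 1 & ~ commute a b]
    & [/\ #[s'] = 2, #[t'] = 2 & s' != t']].
Proof.
move=> [SLi SLj SLs SLt] [i2 j2 iji ncij] [os ot cst nst] sylS.
have nt_sqr x : x ^+ 2 = s -> x ^+ 2 != 1 by move->; rewrite -order_gt1 os.
have pg4 x : x ^+ 2 = s -> 2.-group <[x]>.
  move=> x2; apply: (@pnat_dvd _ 4) => //; rewrite -orderE order_dvdn.
  by rewrite (expgM x 2 2) x2; have := expg_order s; rewrite os => ->.
pose Q := (<[i]> <*> <[j]>)%G.
have nij : <[j]> \subset 'N(<[i]>).
  (* The relation i * j * i = j says that j inverts i, and i^-1 = i ^+ 3. *)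
  rewrite cycle_subG inE -cycleJ cycle_subG; apply/cycleP; exists 3.
  have i4 : i ^+ 4 = 1.
    by rewrite (expgM i 2 2) i2; have := expg_order s; rewrite os.
  have <- : j^-1 * (i * j * i) * i ^+ 3 = i ^ j.
    by rewrite -!mulgA -expgS i4 mulg1 conjgE.
  by rewrite iji mulVg mul1g.
have Q2 : 2.-group Q.
  by rewrite /= (norm_joinEr nij) pgroupM !pg4.
have sQSL : Q \subset L by rewrite join_subG !cycle_subG SLi.
have [u SLu sQSu] := Sylow_Jsub sylS sQSL Q2.
pose K := (<[s]> <*> <[t]>)%G.
have cST : <[t]> \subset 'C(<[s]>) by apply: cents_cycle; apply: commute_sym.
have K2 : 2.-group K.
  by rewrite /= (cent_joinEr cST) pgroupM !pgroup_cycle.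
have sKSL : K \subset L by rewrite join_subG !cycle_subG SLs.
have [v SLv sKSv] := Sylow_Jsub sylS sKSL K2.
exists (i ^ u), (j ^ u), (s ^ v), (t ^ v).
split; split; rewrite ?orderJ //.
- by apply: (subsetP sQSu); rewrite memJ_conjg mem_gen // inE cycle_id.
- by apply: (subsetP sQSu); rewrite memJ_conjg mem_gen // inE cycle_id orbT.
- by apply: (subsetP sKSv); rewrite memJ_conjg mem_gen // inE cycle_id.
- by apply: (subsetP sKSv); rewrite memJ_conjg mem_gen // inE cycle_id orbT.
- by rewrite -conjXg conjg_eq1 nt_sqr.
- by rewrite -conjXg conjg_eq1 nt_sqr.
- move=> cab; case: ncij; apply: (conjg_inj u).
  by rewrite !conjMg; apply: cab.
by rewrite (inj_eq (conjg_inj v)).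
Qed.

Lemma SL33_Sylow3_noncyclic (S : {group {'GL_3['F_3]}}) :
  3.-Sylow(SL33) S -> ~~ cyclic S.
Proof.
have [x [y [SLx SLy ox oy [cxy nxy]]]] := SL33_elements3.
exact: (Sylow_noncyclic _ SLx SLy ox oy cxy nxy).
Qed.

Lemma SL33_Sylow2 (S : {group {'GL_3['F_3]}}) : 2.-Sylow(SL33) S ->
  exists a b s t : {'GL_3['F_3]},
  [/\ [/\ a \in S, b \in S, s \in S & t \in S],
      [/\ a ^+ 2 != 1, b ^+ 2 != 1 & ~ commute a b]
    & [/\ #[s] = 2, #[t] = 2 & s != t]].
Proof.
by have [i [j [s [t [inL Hij Hst]]]]] := SL33_elements2; apply: Sylow2_elements inL Hij Hst.
Qed.

(* In a proper quotient of a generalized quaternion group every element outside *)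
(* the image of the cyclic maximal subgroup squares to 1.                       *)
Lemma quaternion_morphim (aT rT : finGroupType) (D : {group aT})
    (f : {morphism D >-> rT}) a b s t :
    cyclic D || (2 == 2) && (extremal_class D == Quaternion) -> 2.-group D ->
    a \in f @* D -> b \in f @* D -> s \in f @* D -> t \in f @* D ->
    a ^+ 2 != 1 -> b ^+ 2 != 1 -> ~ commute a b ->
    #[s] = 2 -> #[t] = 2 -> s != t -> False.
Proof.
move=> rkD pD fDa fDb fDs fDt a2 b2 ncab os ot nst.
case/orP: (rkD) => [cycD | /eqP/quaternion_classP[n n_gt2 isoD]].
  by case: ncab; apply: (centsP (cyclic_abelian (morphim_cyclic f cycD))).
have [[x y]] := generators_quaternion n_gt2 isoD => genD _.
have [[_ Xo4 _] _ [_ _ oD2 _ _] _ _] := quaternion_structure n_gt2 genD isoD.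
move: oD2; set z := x ^+ _ => oD2.
case/morphimP: fDa => i Di _ def_a; case/morphimP: fDb => j Dj _ def_b.
case/morphimP: fDs => k Dk _ def_s; case/morphimP: fDt => l Dl _ def_t.
(* If [f] is injective, s and t both come from the unique involution of D. Otherwise the kernel
   contains that involution. *)
have [injf | ninjf] := boolP ('injm f).
  have ok : #[k] = 2 by rewrite -(order_injm injf) // -def_s.
  have ol : #[l] = 2 by rewrite -(order_injm injf) // -def_t.
  by case/eqP: nst; rewrite def_s def_t (oD2 k Dk ok) (oD2 l Dl ol).
have sKD : 'ker f \subset D by apply: subsetIl.
have sqr1 u : u \in D -> u \notin <[x]> -> f u ^+ 2 = 1.
  move=> Du Xu; have ou : #[u] = 4 by apply: Xo4; rewrite inE Xu.
  have [||w Kw ow] := @pgroup_order_prime _ 2 ('ker f)%G.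
  - exact: pgroupS sKD pD.
  - by apply: contra ninjf => /eqP->.
  rewrite -morphX // (oD2 (u ^+ 2)) ?groupX //; last by rewrite orderXdiv ou.
  rewrite -(oD2 w) //; first exact: mker.
  exact: (subsetP sKD).
(* So a and b, whose squares are not 1, come from the cyclic subgroup <x>, and they commute. *)
have [Xi | Xi] := boolP (i \in <[x]>); last by rewrite def_a sqr1 ?eqxx in a2.
have [Xj | Xj] := boolP (j \in <[x]>); last by rewrite def_b sqr1 ?eqxx in b2.
case: ncab; rewrite /commute def_a def_b -!morphM //; congr (f _).
exact: (centsP (cycle_abelian x)).
Qed.

End SectionSL33.

(** * Nonsolvable groups *)

Section Nonsolvable.
Variable gT : finGroupType.
Implicit Types (G H N A B D S : {group gT}) (p q r : nat).

Lemma section_adj23 G N : N \subset G -> SL33 \homg N -> adj G 2 3.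
Proof.
move=> sNG /homgP[f fN]; apply: (adj_sub sNG).
apply: (adj_morphim (f := f)) => //; rewrite fN.
have [u [s [SLu SLs ou os cus]]] := SL33_elements6.
by apply: (@adj_commute _ SL33 2 3 s u) => //; rewrite ?ou ?os.
Qed.

(** The image of D is a Sylow subgroup of SL(3,3), which is noncyclic for p = 3 and for p = 2 has
    elements impossible in an image of a cyclic or quaternion group. *)
Lemma section_Sylow_not_rank1 N p D : SL33 \homg N -> (p == 2) || (p == 3) ->
    p.-Sylow(N) D ->
  ~~ (cyclic D || (p == 2) && (extremal_class D == Quaternion)).
Proof.
move=> /homgP[f fN] p23 sylD; apply/negP=> rkD.
have sDN := pHall_sub sylD.
have sylfD : p.-Sylow(SL33) (f @* D).
  by have := morphim_pHall f sDN sylD; rewrite fN.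
pose g := restrm sDN f.
have gD : g @* D = f @* D by rewrite morphim_restrm setIid.
case/orP: p23 => /eqP p_eq; subst p.
  have [a [b [s [t [[Sa Sb Ss St] [a2 b2 ncab] [os ot nst]]]]]] := SL33_Sylow2 sylfD.
  by apply: (@quaternion_morphim _ _ D g a b s t) => //; rewrite ?gD // (pHall_pgroup sylD).
case/orP: rkD => // cycD.
by case/negP: (SL33_Sylow3_noncyclic sylfD); apply: morphim_cyclic.
Qed.

Lemma section_abelem_adj G N A p r : prime p -> prime r -> p != r ->
    (p == 2) || (p == 3) -> N \subset G -> SL33 \homg N ->
    A <| G -> r.-group A -> A :!=: 1 -> adj G p r.
Proof.
move=> p_pr r_pr npr p23 sNG homN /andP[sAG nAG] rA ntA; apply: contraT => nadj.
have [D sylD] := Sylow_exists p N.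
case/negP: (section_Sylow_not_rank1 homN p23 sylD).
have sDG := subset_trans (pHall_sub sylD) sNG.
exact: rank1_of_nonadj nadj sDG sAG (pHall_pgroup sylD) rA ntA (subset_trans sDG nAG).
Qed.

Lemma fixfree_card_mod S y r : prime r -> #[y] = r -> y \in 'N(S) -> 'C_S[y] = 1 ->
  #|S| = 1 %[mod r].
Proof.
move=> r_pr oy nSy CSy.
have rY : r.-group <[y]> by apply: pgroup_cycle.
have actY : [acts <[y]>, on S | 'J] by rewrite astabsJ cycle_subG.
rewrite (pgroup_fix_mod rY actY) afixJ cent_cycle.
by rewrite CSy cards1.
Qed.

(** The product c of the conjugates of b under <y> commutes with y, and its order is divisible by p
    because B meets its centralizer trivially. *)
Lemma conj_orbit_adj G B y b p r : prime p -> prime r -> p != r ->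
    b \in B -> #[b] = p -> B \subset G -> y \in G -> #[y] = r ->
    'Z(B) = 1 -> (forall i, 0 < i < r -> B :^ (y ^+ i) \subset 'C(B)) ->
  adj G p r.
Proof.
move=> p_pr r_pr npr Bb ob sBG Gy oy ZB cB.
case: r r_pr npr oy cB => // r r_pr npr oy cB.
(* Here r stands for the former prime minus 1, so d collects all conjugates of b by nontrivial
   powers of y. *)
pose d := \prod_(i < r) b ^ (y ^+ i.+1); pose c := b * d.
have Cd : d \in 'C(B).
  apply: group_prod => i _; apply: (subsetP (cB i.+1 _)); last by rewrite memJ_conjg.
  by rewrite /= ltnS ltn_ord.
have cbd : commute b d by apply/commute_sym/(centP Cd).
have cy : commute c y.
  apply/commgP/conjg_fixP; rewrite /c conjMg.
  have -> : b ^ y * d ^ y = d * b.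
    have -> : b ^ y * d ^ y = \prod_(i < r.+1) b ^ (y ^+ i.+1).
      rewrite big_ord_recl expg1 -[d ^ y]/(conjg^~ y d) /d; congr (_ * _).
      rewrite (big_morph (conjg^~ y) (fun u v => conjMg u v y) (conj1g y)).
      by apply: eq_bigr => i _; rewrite -conjgM -expgSr.
    by rewrite big_ord_recr /= -oy expg_order conjg1.
  by rewrite cbd.
(* c ^+ n = 1 puts b ^+ n = d ^- n into Z(B) = 1. *)
have pc : p %| #[c].
  rewrite -ob order_dvdn; set n := #[c].
  have cn : b ^+ n * d ^+ n = 1 by rewrite -expgMn // expg_order.
  have : b ^+ n \in 'Z(B).
    rewrite inE groupX //=; have -> : b ^+ n = (d ^+ n)^-1.
      by apply/eqP; rewrite eq_sym eq_invg_mul -(commuteX2 n n cbd) cn.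
    by rewrite groupV groupX.
  by rewrite ZB => /set1gP->.
have Gc : c \in G.
  have Gb := subsetP sBG b Bb; rewrite groupM //; apply: group_prod => i _.
  by rewrite groupJ ?groupX.
by apply: (@adj_commute _ G p r.+1 c y); rewrite ?oy.
Qed.

(** Both B and its conjugate are minimal normal in A; if distinct, they meet trivially and
    commute. *)
Lemma minnormal_conj_cent A B g : minnormal B A -> B \subset A -> g \in 'N(A) ->
  B :^ g = B \/ B :^ g \subset 'C(B).
Proof.
move=> minB sBA nAg; have [/andP[ntB nBA] minB'] := mingroupP minB.
have Ag := normP nAg.
have nsBA : B <| A by rewrite /normal sBA.
have nsBgA : B :^ g <| A by rewrite -{1}Ag normalJ.
have [eqB | neB] := eqVneq (B :^ g) B; [by left | right].
have [tiB | ntiB] := eqVneq (B :&: B :^ g) 1.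
  apply/commG1P/trivgP; rewrite -tiB setIC commg_subI //.
    by rewrite subsetI subxx (subset_trans (normal_sub nsBgA)).
  by rewrite subsetI subxx (subset_trans sBA) ?normal_norm.
have eqI : B :&: B :^ g = B.
  apply: (minB' (B :&: B :^ g)%G); last exact: subsetIl.
  by rewrite /= ntiB normsI ?normal_norm.
case/eqP: neB; apply/esym/eqP; rewrite eqEcard cardJg leqnn andbT.
by apply/setIidPl.
Qed.

(** By minimality A is generated by the G-conjugates of a minimal normal subgroup B of A, and each
    of these equals B or centralizes it. They are normal {2, 3, 13}-subgroups of A, so A is a {2, 3,
    13}-group. *)
Lemma minnormal_nonsolvable G A : minnormal A G -> A \subset G ->
    pseudo_PSL33_solvable A -> ~~ solvable A -> exists B : {group gT},
  [/\ minnormal B A, B \subset A, simple B, B \isog SL33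
    & [pred t | t \in [:: 2; 3; 13]].-group A].
Proof.
move=> minA sAG psA nsolA; have [/andP[ntA nAG] minA'] := mingroupP minA.
have [B minB sBA] := minnormal_exists ntA (normG A).
have [/andP[ntB nBA] minB'] := mingroupP minB.
have nsBA : B <| A by rewrite /normal sBA.
have conjB g : g \in G -> B :^ g = B \/ B :^ g \subset 'C(B).
  by move=> Gg; apply: minnormal_conj_cent minB sBA _; apply: (subsetP nAG).
pose U := \bigcup_(g in G) B :^ g; pose K := <<U>>%G.
have sBK : B \subset K.
  by apply: sub_gen; apply: (bigcup_max 1) => //; rewrite conjsg1.
have sKA : K \subset A.
  rewrite gen_subG; apply/bigcupsP=> g Gg.
  by rewrite -(normsP nAG g Gg) conjSg.
have nKG : G \subset 'N(K).
  apply/normsP=> g Gg; rewrite /= -genJ; congr <<_>>.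
  apply/setP=> x; rewrite mem_conjg; apply/bigcupP/bigcupP=> -[h Gh].
    rewrite -mem_conjg -conjsgM => Bx; exists (h * g) => //; exact: groupM.
  move=> Bx; exists (h * g^-1); first by rewrite groupM ?groupV.
  by rewrite conjsgM mem_conjgV conjgKV.
have defA : K :=: A.
  apply: minA' => //; rewrite nKG andbT.
  by apply: contraNneq ntB => K1; rewrite -subG1 -K1.
have sA_by (M : {group gT}) : (forall g, g \in G -> B :^ g \subset M) -> A \subset M.
  by move=> sM; rewrite -defA gen_subG; apply/bigcupsP.
have psB := pseudo_normal nsBA psA.
(* A normal subgroup of B is also normalized by the conjugates centralizing B, hence by A. *)
have simB : simple B.
  apply/mingroupP; split=> [|M /andP[ntM nMB] sMB]; first by rewrite ntB normG.
  apply: minB' => //; rewrite ntM /=; apply: sA_by => g Gg.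
  case: (conjB g Gg) => [-> // | cBg].
  apply: subset_trans cBg _; apply: subset_trans (cent_sub M).
  exact: centS.
have isoB : B \isog SL33.
  case/orP: (pseudo_simple simB psB) => [abB | isoB]; last first.
    exact: isog_trans isoB PSL33_isog.
  (* If B were abelian, A would centralize B, and Z(A), being nontrivial and G-invariant, would be
     A. *)
  case/negP: nsolA; apply: abelian_sol.
  have cAB : A \subset 'C(B).
    by apply: sA_by => g Gg; case: (conjB g Gg) => [-> // | cBg].
  suffices -> : A :=: 'Z(A) by apply: center_abelian.
  apply/esym/minA'; last exact: center_sub.
  rewrite (char_norm_trans (center_char A)) // andbT.
  apply: contraNneq ntB => ZA; rewrite -subG1 -ZA subsetI sBA.
  by rewrite centsC.
exists B; split=> //.
set pi : nat_pred := [pred t | _].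
have piB : pi.-group B.
  by rewrite /pgroup (card_isog isoB) card_SL33.
suffices sA : A \subset 'O_pi(A) by apply: pgroupS sA (pcore_pgroup _ _).
apply: sA_by => g Gg; apply: pcore_max; first by rewrite pgroupJ.
by rewrite -(normsP nAG g Gg) normalJ.
Qed.

End Nonsolvable.

(** By coprime action y normalizes a Sylow p-subgroup S of B. Without adjacency |S| = 1 mod r: for p
    = 3 this gives r | 26, which is excluded; for p = 2 it gives r | 15, so r = 5, but then |Z(S)|,
    which is 2, 4 or 8 as S is nonabelian, would be 1 mod 5. *)
Lemma simple_fixed_adj (gT : finGroupType) (G B : {group gT}) p r y :
    prime r -> r \notin [:: 2; 3; 13] -> (p == 2) || (p == 3) -> B \subset G ->
    B \isog SL33 -> y \in G -> #[y] = r -> y \in 'N(B) -> adj G p r.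
Proof.
move=> r_pr nr p23 sBG isoB Gy oy nBy.
have oB : #|B| = 5616 by rewrite (card_isog isoB) card_SL33.
have p_pr : prime p by case/orP: p23 => /eqP->.
have npr : p != r.
  by apply: contraNneq nr => <-; rewrite !inE; case/orP: p23 => /eqP->.
have nYB : <[y]> \subset 'N(B) by rewrite cycle_subG.
have coBY : coprime #|B| #|<[y]>|.
  rewrite coprime_sym -orderE oy prime_coprime // oB.
  apply: contra nr => r_dv; have: r \in primes 5616 by rewrite mem_primes r_pr r_dv.
  by rewrite (_ : primes 5616 = [:: 2; 3; 13]).
have [S sylS nYS] := sol_coprime_Sylow_exists p (abelian_sol (cycle_abelian y)) nYB coBY.
have sSG := subset_trans (pHall_sub sylS) sBG.
have pS := pHall_pgroup sylS.
have nSy : y \in 'N(S) by rewrite -cycle_subG.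
apply: contraT => nadj; rewrite adjC in nadj.
have CV (V : {group gT}) : V \subset S -> y \in 'N(V) -> #|V| = 1 %[mod r].
  move=> sVS nVy; apply: (fixfree_card_mod r_pr oy nVy).
  apply: (cent1_pgroup_trivial r_pr p_pr _ nadj _ _ Gy oy); rewrite 1?eq_sym //.
    exact: subset_trans sVS sSG.
  exact: pgroupS sVS pS.
have cardS : #|S| = (if p == 2 then 16 else 27).
  by rewrite (card_Hall sylS) oB p_part; case/orP: p23 => /eqP->.
have dvdr n m : n = 1 %[mod r] -> n = m.+1 -> r %| m.
  by move=> + def_n; rewrite def_n => /eqP; rewrite eqn_mod_dvd // subSS subn0.
have r_dvS : r %| (if p == 2 then 15 else 26).
  by apply: (dvdr _ _ (CV S (subxx _) nSy)); rewrite cardS; case: ifP.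
case/orP: (p23) => /eqP p_eq; rewrite p_eq /= in r_dvS cardS pS sylS; last first.
  have: r \in primes 26 by rewrite mem_primes r_pr r_dvS.
  by rewrite (_ : primes 26 = [:: 2; 13]) // => r26; case/negP: nr; move: r26;
    rewrite !inE => /orP[] ->; rewrite ?orbT.
have r5 : r = 5.
  have: r \in primes 15 by rewrite mem_primes r_pr r_dvS.
  rewrite (_ : primes 15 = [:: 3; 5]) // !inE => /orP[] /eqP // r3.
  by rewrite r3 in nr.
have nZy : y \in 'N('Z(S)) by apply: center_norm.
have := CV 'Z(S)%G (center_sub S) nZy; rewrite r5.
have [k oZ] := p_natP (pgroupS (center_sub S) pS).
have ntZ : 'Z(S) != 1.
  by apply: (center_pgroup_neq1 pS); rewrite -cardG_gt1 cardS.
have ltZ : #|'Z(S)| < 16.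
  rewrite -cardS proper_card // properEneq center_sub andbT.
  apply/eqP=> ZS; have abS : abelian S by rewrite -ZS center_abelian.
  have [h injh hB] := isogP isoB.
  have sylhS : 2.-Sylow(SL33) (h @* S).
    by have := morphim_pHall h (pHall_sub sylS) sylS; rewrite hB.
  have [a [b [s [t [[hSa hSb _ _] [_ _ ncab] _]]]]] := SL33_Sylow2 sylhS.
  by exact: ncab (centsP (morphim_abelian h abS) a hSa b hSb).
have k_lt4 : k < 4 by rewrite -(ltn_exp2l k 4 (isT : 1 < 2)) -oZ.
have k_gt0 : 0 < k by rewrite -(ltn_exp2l 0 k (isT : 1 < 2)) -oZ cardG_gt1.
by rewrite /= oZ; case: k k_lt4 k_gt0 {oZ} => [|[|[|[|]]]].
Qed.

(** Induction through a minimal normal subgroup A. If A is solvable, either r divides |G / A| or A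
    is an r-group on which the Sylow p-subgroups of a group mapping onto SL(3,3) act. If not, an
    element of order r either normalizes a simple factor B of A or moves it to conjugates
    centralizing B. *)
Lemma nonsolvable_adj (gT : finGroupType) (G : {group gT}) p r :
    pseudo_PSL33_solvable G -> ~~ solvable G ->
    prime r -> r %| #|G| -> r \notin [:: 2; 3; 13] -> (p == 2) || (p == 3) -> adj G p r.
Proof.
have [n] := ubnP #|G|; elim: n gT G => // n IHn gT G /ltnSE-leGn psG nsolG.
move=> r_pr r_dv nr p23.
have p_pr : prime p by case/orP: p23 => /eqP->.
have npr : p != r.
  by apply: contraNneq nr => <-; rewrite !inE; case/orP: p23 => /eqP->.
have ntG : G :!=: 1 by apply: contraNneq nsolG => ->; apply: solvable1.
have [A minA sAG] := minnormal_exists ntG (normG G).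
have [/andP[ntA nAG] minA'] := mingroupP minA.
have nsAG : A <| G by rewrite /normal sAG.
have [solA | nsolA] := boolP (solvable A).
  have [r_dvq | nr_dvq] := boolP (r %| #|G / A|).
    apply: (adj_morphim (f := coset_morphism A) _ nAG); first by rewrite muln_gt0 !prime_gt0.
    apply: IHn => //.
    - by apply: leq_trans leGn; rewrite ltn_quotient.
    - exact: pseudo_quotient.
    - by apply: contra nsolG => solQ; rewrite (series_sol nsAG) solA.
  have [_ _ /is_abelemP[t t_pr /abelem_pgroup tA]] := minnormal_solvable minA (subxx A) solA.
  have r_dvA : r %| #|A|.
    move: r_dv; rewrite -(Lagrange sAG) Euclid_dvdM // -card_quotient //.
    by rewrite (negPf nr_dvq) orbF.
  have def_t : t = r.
    have: r \in \pi(#|A|) by rewrite mem_primes r_pr cardG_gt0.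
    by move/(pnatPpi tA)/eqnP.
  rewrite def_t in tA.
  have [N sNG homN] := pseudo_homg_SL33 psG nsolG.
  exact: section_abelem_adj homN nsAG tA ntA.
have [B [minB sBA simB isoB piA]] :=
  minnormal_nonsolvable minA sAG (pseudo_normal nsAG psG) nsolA.
have [y Gy oy] := Cauchy r_pr r_dv.
have sBG := subset_trans sBA sAG.
have [nBy | nBy] := boolP (y \in 'N(B)).
  exact: simple_fixed_adj oy nBy.
have [b Bb ob] : exists2 b, b \in B & #[b] = p.
  have p_dvB : p %| #|B|.
    by rewrite (card_isog isoB) card_SL33; case/orP: p23 => /eqP->.
  by have [b] := Cauchy p_pr p_dvB; exists b.
have [ntB simB'] := simpleP _ simB.
have nabB : ~~ abelian B.
  rewrite (isog_abelian isoB); apply/negP=> ab.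
  have [i [j [s [t [[SLi SLj _ _] [_ _ _ ncij] _]]]]] := SL33_elements2.
  by case: ncij; apply: (centsP ab).
have ZB : 'Z(B) = 1.
  have [//|ZB] := simB' 'Z(B)%G (center_normal B).
  by case/negP: nabB; rewrite -ZB center_abelian.
apply: (conj_orbit_adj p_pr r_pr npr Bb ob sBG Gy oy ZB) => i /andP[i_gt0 i_ltr].
have nAyi : y ^+ i \in 'N(A) by rewrite groupX // (subsetP nAG).
case: (minnormal_conj_cent minB sBA nAyi) => // /normP nByi.
by case/negP: nBy; rewrite -cycle_subG -(cycle_expg_prime r_pr oy (i := i)) ?i_gt0 // cycle_subG.
Qed.

(* At a nonabelian minimal normal subgroup [A], Frattini's argument replaces the *)
(* group by the normalizer of a Sylow 13-subgroup [S] of [A]; the part of this   *)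
(* normalizer inside [A] is {2,3}-by-S, hence solvable by Burnside's theorem.    *)
Lemma pseudo_sol_subgroup (gT : finGroupType) (G : {group gT}) :
  pseudo_PSL33_solvable G -> exists H : {group gT},
    [/\ H \subset G, solvable H
      & forall t, prime t -> t %| #|G| -> t \notin [:: 2; 3] -> t %| #|H|].
Proof.
have [n] := ubnP #|G|; elim: n gT G => // n IHn gT G /ltnSE-leGn psG.
have [solG | nsolG] := boolP (solvable G); first by exists G; split.
have ntG : G :!=: 1 by apply: contraNneq nsolG => ->; apply: solvable1.
have [A minA sAG] := minnormal_exists ntG (normG G).
have [/andP[ntA nAG] minA'] := mingroupP minA.
have nsAG : A <| G by rewrite /normal sAG.
have [||Hq [sHq solHq dvHq]] := IHn _ (G / A)%G.
- by apply: leq_trans leGn; rewrite ltn_quotient.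
- exact: pseudo_quotient.
have [L defHq sAL sLG] := inv_quotientS nsAG sHq.
have nsAL : A <| L := normalS sAL sLG nsAG.
have dvG t : prime t -> t %| #|G| -> t %| #|A| \/ t %| #|G / A|.
  by move=> t_pr; rewrite -(Lagrange sAG) Euclid_dvdM // -card_quotient // => /orP.
have [solA | nsolA] := boolP (solvable A).
  exists L; split=> //; first by rewrite (series_sol nsAL) solA -defHq.
  move=> t t_pr t_dv t23; case: (dvG t t_pr t_dv) => t_dv'.
    exact: dvdn_trans t_dv' (cardSg sAL).
  apply: dvdn_trans (dvHq t t_pr t_dv' t23) _.
  by rewrite defHq dvdn_quotient.
have [B [minB sBA simB isoB piA]] :=
  minnormal_nonsolvable minA sAG (pseudo_normal nsAG psG) nsolA.
have [S sylS] := Sylow_exists 13 A.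
have defL := Frattini_arg nsAL sylS.
have nAL := normal_norm nsAL.
have nAN : 'N_L(S) \subset 'N(A) by rewrite subIset ?nAL.
(* By the Frattini argument the normalizer covers L / A, so no prime of the quotient is lost. *)
have isoN : 'N_L(S) / (A :&: 'N_L(S)) \isog L / A.
  by rewrite -[L in L / A]defL quotientMidl second_isog.
have nsAN : A :&: 'N_L(S) <| 'N_L(S) by rewrite /normal subsetIr normsI ?normG.
have solNA : solvable (A :&: 'N_L(S)).
  have eN : A :&: 'N_L(S) = 'N_A(S) by rewrite setIA (setIidPl sAL).
  rewrite eN.
  have nsS : S <| 'N_A(S) by rewrite normalSG ?(pHall_sub sylS).
  rewrite (series_sol nsS) (pgroup_sol (pHall_pgroup sylS)) /=.
  apply: integral_char.Burnside_p_a_q_b.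
  have sNA : 'N_A(S) \subset A := subsetIl _ _.
  (* Burnside's theorem is stated as a bound 2 on the number of prime divisors. *)
  apply: (@uniq_leq_size _ _ [:: 2; 3]); first exact: primes_uniq.
  move=> t; rewrite mem_primes => /and3P[t_pr _ t_dv].
  have t13 : t != 13.
    have sylSN : 13.-Sylow('N_A(S)) S.
      by apply: pHall_subl sylS; rewrite ?subsetIl // normal_sub.
    have : (13^').-nat #|'N_A(S) / S|.
      by rewrite card_quotient ?normal_norm //; case/and3P: sylSN.
    move=> npi; apply: contraTneq t_dv => t_eq; by rewrite -p'natE // t_eq.
  have : t \in [pred t | t \in [:: 2; 3; 13]].
    apply: pnatPpi piA _; rewrite mem_primes t_pr cardG_gt0.
    by apply: dvdn_trans t_dv (dvdn_trans (dvdn_quotient _ _) (cardSg sNA)).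
  by rewrite !inE (negPf t13) orbF.
exists ('N_L(S))%G; split.
- exact: subset_trans (subsetIl _ _) sLG.
- by rewrite (series_sol nsAN) solNA (isog_sol isoN) /= -defHq.
move=> t t_pr t_dv t23; case: (dvG t t_pr t_dv) => t_dv'.
  have : t \in [pred t | t \in [:: 2; 3; 13]].
    by apply: pnatPpi piA _; rewrite mem_primes t_pr cardG_gt0.
  move: t23; rewrite !inE orbA => /negPf-> /= /eqP t13.
  apply: dvdn_trans (_ : t %| #|S|) (cardSg _).
    by apply: (Hall_pdvd sylS) => //; rewrite !inE t13.
  by rewrite subsetI normG (subset_trans (pHall_sub sylS)).
apply: dvdn_trans (dvHq t t_pr t_dv' t23) _.
rewrite defHq -(card_isog isoN); exact: dvdn_quotient.
Qed.

Lemma pseudo_adj23 (gT : finGroupType) (G : {group gT}) s t :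
    pseudo_PSL33_solvable G -> ~~ solvable G -> s \in [:: 2; 3] ->
    prime t -> t %| #|G| -> t != s -> t != 13 -> adj G s t.
Proof.
move=> psG nsolG s23 t_pr t_dv ts t13.
have [N sNG homN] := pseudo_homg_SL33 psG nsolG.
have a23 := section_adj23 sNG homN.
have [t23 | t23] := boolP (t \in [:: 2; 3]).
  by move: s23 t23 ts; rewrite !inE => /orP[]/eqP-> /orP[]/eqP-> //; rewrite adjC.
apply: nonsolvable_adj => //; move: t23 s23; rewrite !inE //.
by rewrite orbA (negPf t13) orbF.
Qed.

(** In the nonsolvable case, a prime 2 or 3 among the three is adjacent to one of the others, since
    at most one of them is 13. Otherwise all three divide the order of the solvable subgroup. *)
Lemma pseudo_three_primes (gT : finGroupType) (G : {group gT}) p q r :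
    pseudo_PSL33_solvable G -> prime p -> prime q -> prime r ->
    p != q -> q != r -> p != r ->
    p %| #|G| -> q %| #|G| -> r %| #|G| ->
  [|| adj G p q, adj G q r | adj G p r].
Proof.
move=> psG p_pr q_pr r_pr npq nqr npr p_dv q_dv r_dv.
have [solG | nsolG] := boolP (solvable G); first exact: sol_three_primes.
have key s t u : s \in [:: 2; 3] -> prime t -> prime u -> t %| #|G| -> u %| #|G| ->
    t != s -> u != s -> t != u -> adj G s t || adj G s u.
  move=> s23 t_pr u_pr t_dv u_dv ts us tu.
  have [t13 | t13] := eqVneq t 13; last by rewrite pseudo_adj23.
  by rewrite orbC pseudo_adj23 // -t13 eq_sym.
have [H [sHG solH dvH]] := pseudo_sol_subgroup psG.
have [nqp nrq nrp] : [/\ q != p, r != q & r != p] by split; rewrite eq_sym.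
have [p23 | p23] := boolP (p \in [:: 2; 3]).
  by case/orP: (key p q r p23 q_pr r_pr q_dv r_dv nqp nrp nqr) => ->; rewrite ?orbT.
have [q23 | q23] := boolP (q \in [:: 2; 3]).
  case/orP: (key q p r q23 p_pr r_pr p_dv r_dv npq nrq npr) => [|->]; last by rewrite orbT.
  by rewrite adjC => ->.
have [r23 | r23] := boolP (r \in [:: 2; 3]).
  case/orP: (key r p q r23 p_pr q_pr p_dv q_dv npr nqr npq); rewrite adjC => ->.
    by rewrite !orbT.
  by rewrite orbT.
have := sol_three_primes solH p_pr q_pr r_pr npq nqr npr
  (dvH p p_pr p_dv p23) (dvH q q_pr q_dv q23) (dvH r r_pr r_dv r23).
by case/or3P=> /(adj_sub sHG)->; rewrite ?orbT.
Qed.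

Lemma pseudo_coloring (gT : finGroupType) (G : {group gT}) :
  pseudo_PSL33_solvable G ->
  exists c : nat -> 'I_3, forall p q, prime p -> prime q -> p != q ->
    p %| #|G| -> q %| #|G| -> ~~ adj G p q -> c p != c q.
Proof.
move=> psG; have [solG | nsolG] := boolP (solvable G); first exact: sol_coloring.
have [H [sHG solH dvH]] := pseudo_sol_subgroup psG.
have [c cP] := sol_coloring solH.
(* Only 13 can be nonadjacent to 2 or 3, and 2 and 3 are adjacent, so both may receive any one color
   other than that of 13. *)
pose d : 'I_3 := if c 13 == ord0 then ord_max else ord0.
have d13 : d != c 13.
  by rewrite /d; case: ifP => [/eqP-> // | /negbT]; rewrite eq_sym.
pose c' t := if t \in [:: 2; 3] then d else c t.
have main s t : s \in [:: 2; 3] -> prime t -> t %| #|G| -> t != s ->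
    ~~ adj G s t -> c' s != c' t.
  move=> s23 t_pr t_dv ts nadj; rewrite {1}/c' s23.
  have -> : t = 13; last by [].
  apply/eqP; apply: contraNT nadj => t13; exact: (pseudo_adj23 psG nsolG).
exists c' => p q p_pr q_pr npq p_dv q_dv nadj.
have [p23 | p23] := boolP (p \in [:: 2; 3]).
  by apply: main => //; rewrite eq_sym.
have [q23 | q23] := boolP (q \in [:: 2; 3]).
  by rewrite eq_sym; apply: main; rewrite // adjC.
rewrite /c' (negPf p23) (negPf q23); apply: cP; rewrite ?dvH //.
by apply: contra nadj; apply: adj_sub.
Qed.

(** * Primes congruent to 1 *)

Section PrimesOneMod.
Import GRing.Theory Num.Theory.
Local Open Scope ring_scope.

(** X^n - 1 is separable modulo q, so a root of Phi_n is not a root of Phi_d for a proper divisor d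
    of n, and its order is exactly n. *)
Lemma Cyclotomic_prim_root (q n : nat) (y : 'F_q) : prime q -> (0 < n)%N ->
  n%:R != 0 :> 'F_q -> root (map_poly intr ('Phi_n)) y -> n.-primitive_root y.
Proof.
move=> q_pr n_gt0 nq_neq0 rootPn.
pose P d : {poly 'F_q} := map_poly intr 'Phi_d.
have prodP m : (0 < m)%N -> \prod_(d <- divisors m) P d = 'X^m - 1.
  move=> m_gt0; rewrite -rmorph_prod prod_Cyclotomic //.
  by rewrite rmorphB rmorph1 /= map_polyXn.
have n_in : n \in divisors n by rewrite -dvdn_divisors.
have rootXn : root ('X^n - 1) y.
  rewrite -prodP // (big_rem n) //= rootM; apply/orP; by left.
have yn1 : y ^+ n = 1.
  by move: rootXn; rewrite rootE !hornerE subr_eq0 => /eqP.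
have [m m_prim m_dv] := prim_order_exists n_gt0 yn1.
have m_gt0 := prim_order_gt0 m_prim.
have [-> //|neq_mn] := eqVneq n m.
have : root ('X^m - 1) y by rewrite rootE !hornerE prim_expr_order ?subrr.
rewrite -prodP // rootE horner_prod prodf_seq_eq0 => /hasP[d d_in /= rootPd].
have d_dv_m : (d %| m)%N by rewrite dvdn_divisors.
have neq_dn : d != n.
  by apply: contraNneq neq_mn => d_n; rewrite eqn_dvd m_dv -d_n d_dv_m.
have := separable_Xn_sub_1 nq_neq0.
rewrite -prodP // (big_rem n) //= separable_mul => /and3P[_ _ coP].
have := coprimep_root coP rootPn; rewrite horner_prod => /negP[].
rewrite prodf_seq_eq0; apply/hasP; exists d => //.
rewrite mem_rem_uniq ?divisors_uniq // inE neq_dn -dvdn_divisors //.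
exact: dvdn_trans d_dv_m m_dv.
Qed.

Lemma prime_one_mod (n : nat) : (0 < n)%N -> exists2 q, prime q & (n %| q.-1)%N.
Proof.
(* Among enough multiples x of n one avoids the roots of [r], so that Phi_n(x) is none of 0, 1, -1
   and has a prime divisor q. *)
move=> n_gt0; pose p : {poly int} := 'Phi_n; pose r := p * (p - 1) * (p + 1).
have sz_p : (1 < size p)%N by rewrite size_Cyclotomic ltnS totient_gt0.
have neq_p (c : int) : p != c%:P.
  by apply: contraTneq sz_p => ->; rewrite -leqNgt size_polyC leq_b1.
have r_neq0 : r != 0.
  by rewrite !mulf_neq0 // ?subr_eq0 ?addr_eq0 -?polyC1 -?polyCN //; apply: neq_p.
pose rs := [seq (n * k)%N%:Z | k <- iota 0 (size r)].
have [k rk] : exists k, ~~ root r (n * k)%N%:Z.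
  have uniq_rs : uniq rs.
    rewrite map_inj_uniq ?iota_uniq // => i j [] /eqP.
    by rewrite eqn_pmul2l // => /eqP.
  have : ~~ all (root r) rs.
    apply/negP=> /(max_poly_roots r_neq0)/(_ uniq_rs).
    by rewrite size_map size_iota ltnn.
  by rewrite -has_predC => /hasP[_ /mapP[k _ ->] rk]; exists k.
pose x := (n * k)%N%:Z; pose v := p.[x].
have v_gt1 : (1 < `|v|)%N.
  move: rk; rewrite rootE !hornerE -/v !mulf_eq0 !negb_or subr_eq0 addr_eq0.
  by case: v => [[|[|]]|[|]].
pose q := pdiv `|v|; have q_pr : prime q by apply: pdiv_prime.
have rootp : root (map_poly intr p : {poly 'F_q}) (x%:~R).
  rewrite rootE horner_map -/v /=.
  have /dvdzP[w ->] : (q %| v)%Z by apply: pdiv_dvd.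
  by rewrite rmorphM /= -[(q%:Z)%:~R]/(q%:R) pchar_Fp_0 // mulr0.
(* If q divided n it would divide x, while Phi_n(x) divides x^n - 1. *)
have nq_neq0 : n%:R != 0 :> 'F_q.
  apply/eqP=> n0.
  have : \prod_(d <- divisors n) map_poly intr 'Phi_d = 'X^n - 1 :> {poly 'F_q}.
    rewrite -rmorph_prod prod_Cyclotomic // rmorphB rmorph1 /= map_polyXn //.
  move/(congr1 (fun u => u.[x%:~R])); rewrite (big_rem n) -?dvdn_divisors //=.
  rewrite hornerM (rootP rootp) mul0r !hornerE.
  rewrite -[x%:~R]/((n * k)%N%:R) natrM n0 mul0r expr0n.
  by rewrite (gtn_eqF n_gt0) sub0r => /eqP; rewrite eq_sym oppr_eq0 oner_eq0.
exists q => //; have prim_y := Cyclotomic_prim_root q_pr n_gt0 nq_neq0 rootp.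
rewrite (prim_order_dvd prim_y).
set y : 'F_q := x%:~R in prim_y *.
have y_neq0 : y != 0.
  apply/eqP=> y0; have := prim_expr_order prim_y.
  by rewrite y0 expr0n (gtn_eqF n_gt0) => /eqP; rewrite eq_sym oner_eq0.
apply/eqP/(mulIf y_neq0); rewrite mul1r -exprSr prednK ?prime_gt0 //.
by have := expf_card y; rewrite card_Fp.
Qed.

End PrimesOneMod.

(** * Extensions by induced modules *)

Section Wreath.
Variables (gT : finGroupType) (r : nat).

(** The regular wreath product of F_r by the whole type, with functions under right translation; the
    submodule and the group acting on it are cut out by [ext_set]. *)
Definition wreath := ({ffun gT -> 'F_r} * gT)%type.

HB.instance Definition _ := Finite.on wreath.

Definition shift (g : gT) (f : {ffun gT -> 'F_r}) : {ffun gT -> 'F_r} :=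
  [ffun t => f (t * g)].

Definition wreath_one : wreath := (0%R, 1).
Definition wreath_mul (x y : wreath) : wreath := ((x.1 + shift x.2 y.1)%R, x.2 * y.2).
Definition wreath_inv (x : wreath) : wreath := ((- shift x.2^-1 x.1)%R, x.2^-1).

Lemma shift1 f : shift 1 f = f.
Proof. by apply/ffunP=> t; rewrite ffunE mulg1. Qed.

Lemma shiftM g h f : shift (g * h) f = shift g (shift h f).
Proof. by apply/ffunP=> t; rewrite !ffunE mulgA. Qed.

Lemma shiftD g f1 f2 : shift g (f1 + f2)%R = (shift g f1 + shift g f2)%R.
Proof. by apply/ffunP=> t; rewrite !ffunE. Qed.

Lemma shift0 g : shift g 0%R = 0%R.
Proof. by apply/ffunP=> t; rewrite !ffunE. Qed.

Lemma wreath_mulA : associative wreath_mul.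
Proof.
move=> x y z; rewrite /wreath_mul /= shiftD shiftM GRing.addrA mulgA.
by [].
Qed.

Lemma wreath_mul1 : left_id wreath_one wreath_mul.
Proof. by case=> f g; rewrite /wreath_mul /= shift1 GRing.add0r mul1g. Qed.

Lemma wreath_mulV : left_inverse wreath_one wreath_inv wreath_mul.
Proof. by case=> f g; rewrite /wreath_mul /= GRing.addNr mulVg. Qed.

HB.instance Definition _ :=
  Finite_isGroup.Build wreath wreath_mulA wreath_mul1 wreath_mulV.

Lemma wreathM (x y : wreath) : x * y = ((x.1 + shift x.2 y.1)%R, x.2 * y.2) :> wreath.
Proof. by []. Qed.

Definition wreath_proj (x : wreath) : gT := x.2.

Lemma wreath_projM : {in setT &, {morph wreath_proj : x y / x * y}}.
Proof. by []. Qed.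

Canonical wreath_proj_morphism := Morphism wreath_projM.

Definition wreath_in (g : gT) : wreath := (0%R, g).

Lemma wreath_inM : {in setT &, {morph wreath_in : g h / g * h}}.
Proof. by move=> g h _ _; rewrite /wreath_in wreathM /= shift0 GRing.addr0. Qed.

Canonical wreath_in_morphism := Morphism wreath_inM.

Lemma injm_wreath_in : 'injm wreath_in.
Proof. by apply/injmP=> g h _ _ []. Qed.

Lemma wreath_baseX f n : ((f, 1) : wreath) ^+ n = ((f *+ n)%R, 1) :> wreath.
Proof.
elim: n => [|n IHn] //; rewrite expgS IHn wreathM /= shift1 mulg1.
by rewrite GRing.mulrS.
Qed.

Lemma wreath_base_order f : prime r -> f != 0%R -> #[(f, 1) : wreath] = r.
Proof.
move=> r_pr ntf; apply: nt_prime_order => //.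
  rewrite wreath_baseX; congr pair; apply/ffunP=> t; rewrite ffunMnE ffunE.
  by rewrite -GRing.mulr_natr pchar_Fp_0 // GRing.mulr0.
by apply: contra ntf => /eqP[->].
Qed.

Lemma wreath_order_dvd (x : wreath) : prime r -> #[x] %| #[x.2] * r.
Proof.
move=> r_pr; rewrite order_dvdn expgM.
have -> : x ^+ #[x.2] = ((x ^+ #[x.2]).1, 1) :> wreath.
  apply: injective_projections => //=.
  by rewrite -[LHS]/(wreath_proj (x ^+ _)) morphX ?inE // expg_order.
have [-> | nt1] := eqVneq (x ^+ #[x.2]).1 0%R; first by rewrite wreath_baseX GRing.mul0rn.
by rewrite -order_dvdn wreath_base_order.
Qed.

Lemma wreath_proj_order (x : wreath) :
  prime r -> coprime #[x] r -> #[x.2] = #[x].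
Proof.
move=> r_pr co_xr; apply/eqP; rewrite eqn_dvd -(Gauss_dvdl _ co_xr) wreath_order_dvd // andbT.
by apply: (morph_order wreath_proj_morphism); rewrite inE.
Qed.

End Wreath.

(* [chi] is a character of [K] with values in Z/M, written additively; [N] picks *)
(* out the primes whose elements lie in [K] but not in the kernel of [chi].      *)
Definition char_data (gT : finGroupType) (G : {group gT}) (N : pred nat)
    (K : {group gT}) (M : nat) (chi : gT -> nat) :=
  [/\ K <| G, M %| #|G|,
      {in K &, forall x y, chi (x * y) = chi x + chi y %[mod M]}
    & {in G, forall x, prime #[x] -> N #[x] = (x \in K) && ~~ (M %| chi x)}].

Section CharData.
Variables (gT : finGroupType) (G : {group gT}) (N : pred nat).
Variables (K : {group gT}) (M : nat) (chi : gT -> nat).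
Hypothesis cD : char_data G N K M chi.

Lemma char_data_M_gt0 : 0 < M.
Proof. by have [_ M_dv _ _] := cD; apply: dvdn_gt0 (cardG_gt0 G) M_dv. Qed.

Lemma char_data_1 : M %| chi 1.
Proof.
have [_ _ chiM _] := cD; have := chiM 1 1 (group1 K) (group1 K).
move/eqP; rewrite mulg1 -{1}[chi 1]addn0 eqn_modDl => /eqP.
by rewrite mod0n /dvdn => ->.
Qed.

Lemma char_data_X x n : x \in K -> chi (x ^+ n) = n * chi x %[mod M].
Proof.
have [_ _ chiM _] := cD; move=> Kx.
elim: n => [|n IHn]; first by rewrite expg0 mul0n mod0n; apply/eqP/char_data_1.
by rewrite expgS chiM ?groupX // mulSn -modnDmr IHn modnDmr.
Qed.

Lemma char_data_V x : x \in K -> M %| chi x + chi x^-1.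
Proof.
move=> Kx; have [_ _ chiM _] := cD; have := chiM x x^-1 Kx (groupVr Kx).
by rewrite mulgV /dvdn => <-; apply: char_data_1.
Qed.

End CharData.

Section Extension.
Variables (gT : finGroupType) (G : {group gT}) (N : pred nat).
Variables (K : {group gT}) (M : nat) (chi : gT -> nat) (r : nat) (w : 'F_r).
Hypotheses (cD : char_data G N K M chi) (r_pr : prime r) (nrG : ~~ (r %| #|G|)).
Hypothesis (prim_w : M.-primitive_root%R w).
Import GRing.Theory.
Implicit Types f : {ffun gT -> 'F_r}.

(* The functions satisfying [ext_fun] form the module induced from the character *)
(* [w ^+ chi] of [K], on which [G] acts by right translation.                    *)
Definition ext_fun (f : {ffun gT -> 'F_r}) :=
  [forall t, (t \notin G) ==> (f t == 0%R)] &&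
  [forall k in K, forall t in G, f (k * t) == (w ^+ chi k * f t)%R].

Lemma ext_funP f : reflect
  ((forall t, t \notin G -> f t = 0%R) /\
   {in K & G, forall k t, f (k * t) = (w ^+ chi k * f t)%R}) (ext_fun f).
Proof.
apply: (iffP andP) => [[/forallP supp /forall_inP equiv] | [supp equiv]]; split.
- by move=> t Gt; have := supp t; rewrite Gt => /eqP.
- by move=> k t Kk Gt; apply/eqP; move/forall_inP: (equiv k Kk); apply.
- by apply/forallP=> t; apply/implyP=> Gt; rewrite supp.
by apply/forall_inP=> k Kk; apply/forall_inP=> t Gt; rewrite equiv.
Qed.

Lemma ext_fun0 : ext_fun 0%R.
Proof. by apply/ext_funP; split=> [t|k t] *; rewrite !ffunE ?mulr0. Qed.

Lemma ext_funD f1 f2 : ext_fun f1 -> ext_fun f2 -> ext_fun (f1 + f2)%R.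
Proof.
move=> /ext_funP[s1 e1] /ext_funP[s2 e2]; apply/ext_funP; split=> [t Gt|k t Kk Gt].
  by rewrite ffunE s1 // s2 // addr0.
by rewrite !ffunE e1 // e2 // mulrDr.
Qed.

Lemma ext_fun_shift g f : g \in G -> ext_fun f -> ext_fun (shift g f).
Proof.
move=> Gg /ext_funP[s e]; apply/ext_funP; split=> [t Gt|k t Kk Gt].
  by rewrite ffunE s // groupMr.
by rewrite !ffunE -mulgA e // groupM.
Qed.

Definition ext_set := [set x : wreath gT r | ext_fun x.1 && (x.2 \in G)].

Lemma ext_group_set : group_set ext_set.
Proof.
apply/group_setP; split; first by rewrite inE ext_fun0 group1.
move=> x y; rewrite !inE => /andP[fx Gx] /andP[fy Gy].
by rewrite wreathM /= groupM // andbT ext_funD ?ext_fun_shift.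
Qed.

Canonical ext_group := Group ext_group_set.
Local Notation E := ext_group.

Lemma ext_proj x : x \in E -> x.2 \in G.
Proof. by rewrite inE => /andP[]. Qed.

Lemma ext_in g : g \in G -> wreath_in r g \in E.
Proof. by move=> Gg; rewrite inE ext_fun0. Qed.

Lemma ext_inS : wreath_in r @* G \subset E.
Proof. by apply/subsetP=> _ /morphimP[g _ Gg ->]; apply: ext_in. Qed.

Lemma ext_projE : wreath_proj (r := r) @* E = G.
Proof.
apply/setP=> g; apply/morphimP/idP=> [[x _ Ex ->] | Gg]; first exact: ext_proj.
by exists (wreath_in r g); rewrite ?inE ?ext_fun0.
Qed.

Lemma order_coprime_r g : g \in G -> coprime #[g] r.
Proof.
move=> Gg; rewrite coprime_sym prime_coprime //.
by apply: contra nrG => /dvdn_trans; apply; apply: order_dvdG.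
Qed.

Lemma ext_sol : solvable G -> solvable E.
Proof.
move=> solG; pose f := restrm (subsetT E) (@wreath_proj_morphism gT r).
have fE : f @* E = G by rewrite morphim_restrm setIid; apply: ext_projE.
rewrite (series_sol (ker_normal f)) (isog_sol (first_isog f)) /= fE solG andbT.
apply: abelian_sol; apply/centsP=> x /morphpreP[_ /set1P x1] y /morphpreP[_ /set1P y1].
have {}x1 : x.2 = 1 := x1; have {}y1 : y.2 = 1 := y1.
case: x y x1 y1 => [f1 g1] [f2 g2] /= -> ->.
by rewrite /commute !wreathM /= !shift1 addrC.
Qed.


Lemma prim_exp_eq1 i : (w ^+ i == 1)%R = (M %| i).
Proof. by rewrite (prim_order_dvd prim_w). Qed.

(** Extend w ^+ chi by zero outside K and sum its translates under <x>. The value at 1 is the order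
    of x, nonzero in F_r, when x lies in the kernel of chi; it is 1 when x has prime order and lies
    outside K. *)
Lemma ext_fixed x : x \in G -> (x == 1) || prime #[x] && ~~ N #[x] ->
  exists f, [/\ ext_fun f, f != 0%R & shift x f = f].
Proof.
move=> Gx xP; have [nsKG M_dv chiM NP] := cD; have [sKG nKG] := andP nsKG.
pose f0 : {ffun gT -> 'F_r} := [ffun t => if t \in K then w ^+ chi t else 0]%R.
have ext_f0 : ext_fun f0.
  apply/ext_funP; split=> [t Gt|k t Kk Gt]; rewrite !ffunE.
    by rewrite (negPf (contra (subsetP sKG t) Gt)).
  rewrite groupMl //; case: ifP => Kt; last by rewrite mulr0.
  by rewrite -exprD; apply/eqP; rewrite (eq_prim_root_expr prim_w); apply/eqP/chiM.
pose f := (\sum_(j < #[x]) shift (x ^+ j) f0)%R.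
exists f; split.
- apply: (big_ind ext_fun) => [||j _]; [exact: ext_fun0 | exact: ext_funD |].
  by apply: ext_fun_shift; rewrite ?groupX.
- apply/eqP=> /ffunP/(_ 1).
  rewrite sum_ffunE ffunE (eq_bigr (fun j : 'I__ => f0 (x ^+ j))); last first.
    by move=> j _; rewrite ffunE mul1g.
  have [/andP[Kx dv_x] | nKx] := boolP ((x \in K) && (M %| chi x)).
    rewrite (eq_bigr (fun _ => 1%R)) => [|j _]; last first.
      rewrite ffunE groupX //; apply/eqP; rewrite prim_exp_eq1.
      by rewrite /dvdn (char_data_X cD) // -/(dvdn _ _) dvdn_mull.
    rewrite sumr_const card_ord => /eqP; rewrite -(dvdn_pcharf (pchar_Fp r_pr)).
    have := order_coprime_r Gx; rewrite coprime_sym prime_coprime // => /negP.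
    by [].
  have {}nKx : x \notin K.
    apply: contra nKx => Kx; rewrite Kx; case/orP: xP => [/eqP->|/andP[x_pr nNx]].
      exact: (char_data_1 cD).
    by move: nNx; rewrite NP // Kx negbK.
  have x_pr : prime #[x].
    by case/orP: xP => [/eqP x1 | /andP[]] //; rewrite x1 group1 in nKx.
  rewrite (bigD1 (Ordinal (order_gt0 x))) //= big1 => [|j nj0].
    rewrite ffunE group1 addr0; have := char_data_1 cD; rewrite -prim_exp_eq1 => /eqP->.
    by apply/eqP; rewrite oner_eq0.
  rewrite ffunE; case: ifP => // Kxj; case/negP: nKx.
  rewrite -cycle_subG -(cycle_expg_prime x_pr (erefl _) (i := j)) ?cycle_subG //.
  by rewrite ltn_ord andbT lt0n.
have -> : (shift x f = \sum_(j < #[x]) shift (x ^+ j.+1) f0)%R.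
  rewrite (big_morph (shift x) (@shiftD _ _ x) (@shift0 _ _ x)).
  by apply: eq_bigr => j _; rewrite expgS shiftM.
rewrite /f; case: #[x] (expg_order x) => [|n] xn1; first by rewrite !big_ord0.
by rewrite big_ord_recr big_ord_recl /= xn1 expg0 addrC.
Qed.

Lemma ext_pdiv t : prime t -> t %| #|E| = (t %| #|G|) || (t == r).
Proof.
move=> t_pr; apply/idP/orP => [t_dv | [t_dv | /eqP->]].
- have [x Ex ox] := Cauchy t_pr t_dv.
  have := wreath_order_dvd x r_pr; rewrite ox Euclid_dvdM // (dvdn_prime2 t_pr r_pr) => /orP[t_dvx|->].
    by left; apply: dvdn_trans t_dvx (order_dvdG (ext_proj Ex)).
  by right.
- apply: dvdn_trans t_dv _; rewrite -(card_injm (injm_wreath_in gT r) (subsetT G)).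
  exact: cardSg ext_inS.
(* For x = 1 this says that the module is nonzero. *)
have [|f [ext_f ntf _]] := @ext_fixed 1 (group1 G); first by rewrite eqxx.
have Ef : (f, 1) \in E by rewrite inE ext_f group1.
by have := order_dvdG Ef; rewrite wreath_base_order.
Qed.

Lemma ext_adj_old t t' : prime t -> prime t' -> t %| #|G| -> t' %| #|G| ->
  adj E t t' = adj G t t'.
Proof.
move=> t_pr t'_pr t_dv t'_dv; have tt'_gt0 : 0 < t * t' by rewrite muln_gt0 !prime_gt0.
apply/idP/idP; last first.
  case/exists_inP=> g Gg og; apply/exists_inP; exists (wreath_in r g); first exact: ext_in.
  by rewrite (order_injm (injm_wreath_in gT r)) ?inE.
case/exists_inP=> x Ex /eqP ox; apply/exists_inP; exists x.2; first exact: ext_proj.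
rewrite wreath_proj_order ?ox // coprimeMl.
by rewrite ![coprime _ r]coprime_sym !prime_coprime //; apply/andP; split;
  apply: contra nrG; rewrite dvdn_prime2 // => /eqP->.
Qed.

(** Adjacency means that an element of order t has a nonzero fixed vector. If t is in N, all
    conjugates of that element lie in K outside the kernel of chi, which makes every value of a
    fixed vector vanish. *)
Lemma ext_adj_new t : prime t -> t %| #|G| -> adj E t r = ~~ N t.
Proof.
move=> t_pr t_dv; have [nsKG M_dv chiM NP] := cD; have [sKG nKG] := andP nsKG.
have neq_tr : t != r by apply: contra nrG => /eqP <-.
apply/idP/idP=> [/exists_inP[x Ex /eqP ox] | nNt]; last first.
  have [g Gg og] := Cauchy t_pr t_dv.
  have [|f [ext_f ntf fix_f]] := @ext_fixed g Gg; first by rewrite og t_pr nNt orbT.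
  apply: (@adj_commute _ E t r (wreath_in r g) (f, 1)) => //.
  - exact: ext_in.
  - by rewrite inE ext_f group1.
  - by rewrite /commute !wreathM /= fix_f shift1 add0r addr0 mulg1 mul1g.
  - by rewrite (order_injm (injm_wreath_in gT r)) ?inE ?og.
  - by rewrite wreath_base_order.
apply/negP=> Nt.
pose a := x ^+ r; pose b := x ^+ t.
have [Ea Eb] : a \in E /\ b \in E by rewrite !groupX.
have oa : #[a] = t by rewrite orderXdiv ox ?dvdn_mull // mulnK ?prime_gt0.
have ob : #[b] = r by rewrite orderXdiv ox ?dvdn_mulr // mulKn ?prime_gt0.
have cab : commute a b by apply: commuteX2.
have b1 : b.2 = 1.
  apply/eqP; rewrite -order_eq1 -dvdn1.
  have := order_coprime_r (ext_proj Eb).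
  rewrite /coprime => /eqP <-; rewrite dvdn_gcd dvdnn.
  by have := morph_order (wreath_proj_morphism gT r) (in_setT b); rewrite ob.
have oa2 : #[a.2] = t.
  by rewrite wreath_proj_order ?oa // prime_coprime // dvdn_prime2.
have [Ga2 Nta] : a.2 \in G /\ (a.2 \in K) && ~~ (M %| chi a.2).
  by split; [apply: ext_proj | rewrite -NP ?ext_proj ?oa2].
have fix_b : shift a.2 b.1 = b.1.
  have := congr1 fst cab; rewrite !wreathM /= b1 shift1 addrC.
  exact: addIr.
have ext_b : ext_fun b.1 by move: Eb; rewrite inE => /andP[].
have /eqP : b.1 = 0%R.
  apply/ffunP=> s; rewrite [RHS]ffunE; have /ext_funP[supp equiv] := ext_b.
  have [Gs | /supp//] := boolP (s \in G).
  (* Invariance gives b(s) = b(s a) = b((s a s^-1) s), and equivariance turns the right side into a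
     nontrivial root of unity times b(s). *)
  have Gas : a.2 ^ s^-1 \in G by rewrite groupJ ?groupV.
  have /andP[Kas Mas] : (a.2 ^ s^-1 \in K) && ~~ (M %| chi (a.2 ^ s^-1)).
    by rewrite -NP // orderJ oa2.
  have : (b.1 s = w ^+ chi (a.2 ^ s^-1) * b.1 s)%R.
    rewrite -equiv // conjgE invgK !mulgA mulgKV.
    by rewrite -{1}fix_b ffunE.
  move/eqP; rewrite -subr_eq0 -{1}[b.1 s]mul1r -mulrBl mulf_eq0 subr_eq0 eq_sym prim_exp_eq1.
  by rewrite (negPf Mas) /= => /eqP.
apply/negP; apply: contraTneq (prime_gt1 r_pr) => b0; rewrite -ob -leqNgt.
rewrite (_ : b = 1) ?order1 //.
by case: b b0 b1 {Eb ob cab fix_b ext_b} => f g /= -> ->.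
Qed.

(** Elements of order r project to 1, where a character vanishes, so N' must omit r; other prime
    orders survive projection. *)
Lemma char_data_pullback (N' : pred nat) (K' : {group gT}) M' chi' :
    char_data G N' K' M' chi' -> ~~ N' r ->
  char_data E N' (E :&: wreath_proj (r := r) @*^-1 K')%G M' (fun x => chi' x.2).
Proof.
move=> cD' nN'r; have [nsKG M_dv chiM NP] := cD'; have [sKG nKG] := andP nsKG.
have dvGE : #|G| %| #|E|.
  rewrite -(card_injm (injm_wreath_in gT r) (subsetT G)).
  exact: cardSg ext_inS.
split.
- rewrite /normal subsetIl normsI ?normG //.
  apply: subset_trans (_ : wreath_proj (r := r) @*^-1 G \subset _).
    by rewrite -sub_morphim_pre ?subsetT // ext_projE.
  by apply: subset_trans (morphpre_norm _ _); rewrite morphpreS.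
- exact: dvdn_trans M_dv dvGE.
- by move=> x y /setIP[_ /morphpreP[_ Kx]] /setIP[_ /morphpreP[_ Ky]]; apply: chiM.
move=> x Ex x_pr; have Gx := ext_proj Ex.
have -> : (x \in (E :&: wreath_proj (r := r) @*^-1 K')%G) = (x.2 \in K').
  apply/setIP/idP=> [[_ /morphpreP[_]] // | Kx]; split=> //.
  by apply/morphpreP; split; rewrite ?in_setT.
have [oxr | nxr] := eqVneq #[x] r.
  have x1 : x.2 = 1.
    apply/eqP; rewrite -order_eq1 -dvdn1.
    have := order_coprime_r Gx.
    rewrite /coprime => /eqP <-; rewrite dvdn_gcd dvdnn.
    by have := morph_order (wreath_proj_morphism gT r) (in_setT x); rewrite oxr.
  rewrite oxr (negPf nN'r) x1.
  by rewrite (char_data_1 cD') andbF.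
have ox2 : #[x.2] = #[x].
  by rewrite wreath_proj_order // prime_coprime // dvdn_prime2.
by rewrite -ox2 NP // ox2.
Qed.

End Extension.

(** * Combining an old character with the new module *)

Section ProductCharacter.
Variables (gT : finGroupType) (G : {group gT}) (N : pred nat).
Variables (M : nat) (chi : gT -> nat) (r : nat) (w : 'F_r).
Hypotheses (cD : char_data G N G M chi) (r_pr : prime r) (nrG : ~~ (r %| #|G|)).
Hypothesis (prim_w : M.-primitive_root%R w).
Variables (N' : pred nat) (K' : {group gT}) (M' : nat) (chi' : gT -> nat).
Hypotheses (cD' : char_data G N' K' M' chi') (disjN : forall t, N' t -> ~~ N t).
Import GRing.Theory.
Local Notation E := (ext_group G G chi w).

(** Here chi is defined on all of G, so the module is one-dimensional, given by values at 1.
    Restricting to the kernel of chi makes the action on it trivial. *)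
Definition prod_char_set := [set x in E | (x.2 \in K') && (M %| chi x.2)].

(** The pair of the value at 1, modulo r, and of chi', modulo M', packed into one number modulo r *
    M' in the manner of the Chinese remainder theorem. *)
Definition prod_chi (x : wreath gT r) := (val (x.1 1%g) * M' + chi' x.2 * r)%N.

Lemma prod_char_coprime : coprime r M'.
Proof.
have [_ M'_dv _ _] := cD'; rewrite prime_coprime //.
by apply: contra nrG => /dvdn_trans; apply.
Qed.

Lemma prod_char_dvd a b : (r * M' %| a * M' + b * r) = (r %| a) && (M' %| b).
Proof.
have co := prod_char_coprime; rewrite Gauss_dvd //; congr (_ && _).
  by rewrite (dvdn_addl _ (dvdn_mull b (dvdnn r))) Gauss_dvdl.
by rewrite (dvdn_addr _ (dvdn_mull a (dvdnn M'))) Gauss_dvdl // coprime_sym.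
Qed.

Lemma prod_char_group_set : group_set prod_char_set.
Proof.
have [_ _ chiM _] := cD; apply/group_setP; split.
  by rewrite !inE ext_fun0 !group1 (char_data_1 cD).
move=> x y; rewrite [x \in _]inE [y \in _]inE [_ * _ \in _]inE.
move=> /and3P[Ex Kx Mx] /and3P[Ey Ky My].
rewrite groupM //= groupM //= /dvdn chiM ?ext_proj //; last 2 first.
- exact: ext_proj Ex.
- exact: ext_proj Ey.
exact: dvdn_add.
Qed.

Canonical prod_char_group := Group prod_char_group_set.

Lemma val_FpD (a b : 'F_r) : val (a + b)%R = val a + val b %[mod r].
Proof.
have -> : val (a + b)%R = (val a + val b) %% (Zp_trunc (pdiv r)).+2 by [].
by rewrite [X in _ %% X %% _]Fp_cast // modn_mod.
Qed.

(** The product evaluates y.1 at x.2, which is w ^+ chi x.2 = 1 times its value at 1. *)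
Lemma prod_char_value_mul x y : x \in prod_char_set -> y \in prod_char_set ->
  ((x * y)%g.1 1%g = x.1 1%g + y.1 1%g)%R.
Proof.
rewrite !inE => /and3P[/andP[fx Gx] _ Mx] /and3P[/andP[/ext_funP[_ fy] _] _ _].
rewrite wreathM /= !ffunE; congr (_ + _)%R.
have := fy _ _ Gx (group1 G); rewrite mul1g mulg1 => ->.
by move: Mx; rewrite -(prim_exp_eq1 prim_w) => /eqP->; rewrite mul1r.
Qed.

Lemma prod_chiM :
  {in prod_char_set &, forall x y, prod_chi (x * y)%g = prod_chi x + prod_chi y %[mod r * M']}.
Proof.
have [_ _ chi'M _] := cD'; move=> x y Nx Ny.
have [Kx Ky] : x.2 \in K' /\ y.2 \in K'.
  by move: Nx Ny; rewrite !inE => /and3P[_ ? _] /and3P[_ ? _].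
rewrite /prod_chi prod_char_value_mul // addnACA -!mulnDl.
rewrite -modnDm -[RHS]modnDm; congr ((_ + _) %% _).
  by rewrite -!muln_modl val_FpD.
by rewrite ![(r * _)%N]mulnC -!muln_modl chi'M.
Qed.

Lemma prod_char_normal : prod_char_set <| E.
Proof.
have [_ _ chiM _] := cD; have [/andP[sKG nKG] _ _ _] := cD'.
apply/andP; split; first by apply/subsetP=> x; rewrite inE => /andP[].
apply/subsetP=> g Eg; rewrite inE; apply/subsetP=> _ /imsetP[x Nx ->].
have /and3P[Ex Kx Mx] : [&& x \in E, x.2 \in K' & M %| chi x.2].
  by move: Nx; rewrite inE.
have [Gg Gx] := (ext_proj Eg, ext_proj Ex).
have Jx2 : (x ^ g).2 = x.2 ^ g.2 by [].
rewrite in_set groupJ // andTb Jx2.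
rewrite memJ_norm ?(subsetP nKG) // Kx /= /dvdn conjgE.
rewrite chiM ?groupM ?groupV // -modnDmr chiM // modnDmr addnCA.
rewrite -/(dvdn _ _) dvdn_addr //.
by rewrite addnC; apply: (char_data_V cD).
Qed.

(** Elements of order r are nonzero module elements, detected by their value at 1. By disjointness,
    elements of order in N' lie in the kernel of chi, hence in the new subgroup, where chi' detects
    them. *)
Lemma prod_char_data : char_data E (fun t => N' t || (t == r)) prod_char_group (r * M') prod_chi.
Proof.
have [_ M_dv chiM NP] := cD; have [nsKG M'_dv chi'M N'P] := cD'.
have dvE t : prime t -> t %| #|E| = (t %| #|G|) || (t == r) by apply: (ext_pdiv cD r_pr nrG prim_w).
split.
- exact: prod_char_normal.
- rewrite Gauss_dvd ?prod_char_coprime // dvE // eqxx orbT /=.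
  apply: dvdn_trans M'_dv _.
  rewrite -(card_injm (injm_wreath_in gT r) (subsetT G)).
  exact: cardSg (ext_inS _ _ _ _).
- exact: prod_chiM.
move=> x Ex x_pr; have Gx := ext_proj Ex.
have [oxr | nxr] := eqVneq #[x] r.
  have x1 : x.2 = 1.
    apply/eqP; rewrite -order_eq1 -dvdn1.
    have := order_coprime_r r_pr nrG Gx.
    rewrite /coprime => /eqP <-; rewrite dvdn_gcd dvdnn.
    by have := morph_order (wreath_proj_morphism gT r) (in_setT x); rewrite oxr.
  rewrite orbT inE Ex /= x1 group1 (char_data_1 cD) /=.
  rewrite /prod_chi x1 prod_char_dvd (char_data_1 cD') andbT.
  have : x.1 1%g != 0%R.
    apply: contraTneq x_pr => x10.
    have -> : x = 1%g; last by rewrite order1.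
    apply: injective_projections => //=; apply/ffunP=> s; rewrite [RHS]ffunE.
    move: Ex; rewrite inE => /andP[/ext_funP[supp equiv] _].
    have [Gs | /supp //] := boolP (s \in G).
    by have := equiv s _ Gs (group1 G); rewrite mulg1 x10 mulr0.
  move=> nz; apply/esym; apply: contra nz => r_dv; apply/eqP/val_inj => /=.
  apply/eqP; rewrite -leqn0 leqNgt; apply/negP=> lt0.
  have := dvdn_leq lt0 r_dv; rewrite leqNgt; case/negP.
  by rewrite -[X in _ < X](Fp_cast r_pr) ltn_ord.
have co_x : coprime #[x] r by rewrite prime_coprime // dvdn_prime2.
have ox2 : #[x.2] = #[x] by rewrite wreath_proj_order.
have x2_pr : prime #[x.2] by rewrite ox2.
rewrite orbF inE Ex /= -ox2.
have [N'x | nN'x] := boolP (N' #[x.2]).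
  have := disjN N'x; rewrite NP // Gx negbK => ->.
  move: (N'P _ Gx x2_pr); rewrite N'x => /esym/andP[-> nM'x] /=.
  by rewrite /prod_chi prod_char_dvd negb_and nM'x orbT.
(* For the remaining orders chi' vanishes, and the value at 1 is additive on powers of x, so it is
   killed by an order prime to r. *)
apply/esym/negbTE/negP=> /andP[/andP[K'x Mx]]; rewrite /prod_chi prod_char_dvd negb_and.
have M'x : M' %| chi' x.2.
  by move: (N'P _ Gx x2_pr); rewrite (negPf nN'x) K'x => /esym/negbFE.
rewrite M'x orbF => /negP[].
have Nx : x \in prod_char_set by rewrite inE Ex K'x.
have Xn n : ((x ^+ n)%g.1 1%g = x.1 1%g *+ n)%R.
  elim: n => [|n IHn]; first by rewrite expg0 mulr0n [LHS]ffunE.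
  by rewrite expgS prod_char_value_mul ?groupX // IHn mulrS.
have := Xn #[x]; rewrite expg_order [LHS]ffunE => /esym/eqP.
rewrite -mulr_natr mulf_eq0 -(dvdn_pcharf (pchar_Fp r_pr)).
rewrite dvdn_prime2 // [r == _]eq_sym (negPf nxr) orbF => /eqP->.
exact: dvdn0.
Qed.

Lemma prod_char_full : K' :=: G -> (forall x, x \in G -> M %| chi x) -> prod_char_group :=: E.
Proof.
move=> K'G chi0; apply/setP=> x; rewrite in_set K'G; case Ex: (x \in E) => //=.
by rewrite (ext_proj Ex) chi0 ?(ext_proj Ex).
Qed.

End ProductCharacter.

(** * Realization of graphs *)

Lemma Fp_prim_root (r M : nat) : prime r -> 0 < M -> M %| r.-1 ->
  exists w : 'F_r, M.-primitive_root%R w.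
Proof.
move=> r_pr M_gt0 M_dv; have r1_gt0 : 0 < r.-1 by rewrite -subn1 subn_gt0 prime_gt1.
pose rs := [seq x <- enum 'F_r | x != 0%R].
have uniq_rs : uniq rs by rewrite filter_uniq ?enum_uniq.
have : has (r.-1).-primitive_root%R rs.
  apply: has_prim_root => //.
    apply/allP=> x; rewrite mem_filter => /andP[nz_x _].
    rewrite unity_rootE; apply/eqP/(GRing.mulIf nz_x).
    rewrite GRing.mul1r -GRing.exprSr prednK ?prime_gt0 //.
    by have := finfield.expf_card x; rewrite card_Fp.
  rewrite -(card_uniqP uniq_rs).
  have := cardC1 (0%R : 'F_r); rewrite card_Fp // => <-.
  by apply: subset_leq_card; apply/subsetP=> x; rewrite mem_filter mem_enum !inE => ->.
case/hasP=> z _ prim_z; eexists; exact: (dvdn_prim_root prim_z M_dv).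
Qed.

Section Realize.
Variables (W : finType) (e : rel W) (c : W -> 'I_3).
Hypothesis e_sym : symmetric e.
Hypothesis c_proper : forall x y, e x y -> c x != c y.
Hypothesis e_tri : forall x y z, ~~ [&& e x y, e y z & e x z].

Definition prset (pr : W -> nat) (A : pred W) : pred nat :=
  fun t => [exists v, A v && (pr v == t)].

(** [e] is the complement graph: its edges are the nonadjacent pairs. [s] lists the vertices treated
    so far. *)
Definition realizes (s : seq W) (pr : W -> nat) (gT : finGroupType) (G : {group gT}) :=
  [/\ solvable G,
      {in s, forall v, prime (pr v)},
      {in s &, injective pr},
      forall t, prime t -> (t %| #|G|) = (t \in [seq pr v | v <- s])
    & {in s &, forall u v, u != v -> adj G (pr u) (pr v) = ~~ e u v}].

(** Needed for a vertex of color 1, whose earlier neighbors all have color 0. *)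
Definition full_chars (s : seq W) pr (gT : finGroupType) (G : {group gT}) :=
  forall A : pred W, (forall v, A v -> (v \in s) && (c v == 0 :> nat)) ->
  exists M chi, char_data G (prset pr A) G M chi.

(** Needed for a vertex of color 2, whose earlier neighbors have smaller colors and are independent
    by triangle-freeness. *)
Definition indep_chars (s : seq W) pr (gT : finGroupType) (G : {group gT}) :=
  forall A : pred W, (forall v, A v -> (v \in s) && (c v < 2)) ->
    (forall u v, A u -> A v -> ~~ e u v) ->
  exists K M chi, char_data G (prset pr A) K M chi.

Lemma char_data_eq (gT : finGroupType) (G K K' : {group gT}) (N N' : pred nat) M chi :
  char_data G N K M chi -> N =1 N' -> K :=: K' -> char_data G N' K' M chi.
Proof.
move=> + eqN eqK; move=> [nsKG M_dv chiM NP]; rewrite -(group_inj eqK); split=> // x Gx x_pr.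
by rewrite -eqN NP.
Qed.

Lemma trivial_char_data (gT : finGroupType) (G : {group gT}) pr (A : pred W) :
  (forall v, ~~ A v) -> char_data G (prset pr A) G 1 (fun _ => 0).
Proof.
move=> A0; split=> // x Gx x_pr; rewrite dvd1n andbF; apply/existsP=> -[v].
by rewrite (negPf (A0 v)).
Qed.

Lemma prset_mem (s : seq W) pr (A : pred W) u :
  {in s &, injective pr} -> (forall x, A x -> x \in s) -> u \in s ->
  prset pr A (pr u) = A u.
Proof.
move=> inj_pr sA su; apply/existsP/idP=> [[x /andP[Ax /eqP eqx]] | Au].
  by rewrite -(inj_pr x u (sA x Ax) su eqx).
by exists u; rewrite Au eqxx.
Qed.

Section Step.
Variables (s : seq W) (v : W) (pr : W -> nat) (gT : finGroupType) (G : {group gT}).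
Hypotheses (nsv : v \notin s) (c_max : forall u, u \in s -> c u <= c v).
Hypotheses (realG : realizes s pr G) (fullG : full_chars s pr G).
Hypothesis indepG : indep_chars s pr G.

Let low : pred W := fun u => (u \in s) && e u v.

Lemma realize_char : exists K M chi,
  [/\ char_data G (prset pr low) K M chi, c v < 2 -> K :=: G
    & c v == 0 :> nat -> forall x, x \in G -> M %| chi x].
Proof.
have [cv0 | cv0] := boolP (c v == 0 :> nat).
  exists G, 1%N, (fun _ => 0); split=> //; apply: trivial_char_data => u.
  apply/negP=> /andP[su euv]; have := c_proper euv; have := c_max su.
  by rewrite (eqP cv0) leqn0 => /eqP cu0; rewrite -val_eqE /= cu0 (eqP cv0).
have low_lt u : low u -> (u \in s) && (c u < c v).
  move=> /andP[su euv]; rewrite su ltn_neqAle c_max // andbT.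
  by have := c_proper euv; rewrite -val_eqE.
have [cv2 | cv2] := boolP (c v < 2).
  have [u /low_lt/andP[su cu]|M [chi cD]] := fullG (A := low).
    by rewrite su -leqn0 -ltnS (leq_trans cu).
  by exists G, M, chi; split=> // cv; rewrite cv in cv0.
have [u /low_lt/andP[su cu] | x y /andP[_ exv] /andP[_ eyv] | K [M [chi cD]]] :=
  indepG (A := low).
- by rewrite su (leq_trans cu) // -ltnS ltn_ord.
- by apply: contra (e_tri x y v) => exy; rewrite exy eyv exv.
by exists K, M, chi; split=> // cv; rewrite cv in cv0.
Qed.

(** The new group extends G by the module for the neighbors of v in s. A set A without v gets its
    character by pullback; if A contains v, then K = G and the product character extends the one for
    the rest of A, which contains no neighbor of v. *)
Lemma realize_step : exists pr' (gT' : finGroupType) (G' : {group gT'}),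
  [/\ realizes (v :: s) pr' G', full_chars (v :: s) pr' G'
    & indep_chars (v :: s) pr' G'].
Proof.
have [solG pr_pr inj_pr divG adjG] := realG.
have [K [M [chi [cD KG chi0]]]] := realize_char.
(* The congruence r = 1 mod |G| keeps r prime to |G| and gives F_r a primitive M-th root of
   unity. *)
have [r r_pr r_dv] := prime_one_mod (cardG_gt0 G).
have nrG : ~~ (r %| #|G|).
  apply/negP=> /dvdn_trans/(_ r_dv)/dvdn_leq; rewrite -subn1 subn_gt0 prime_gt1 //.
  by move/(_ isT); rewrite leqNgt subn1 prednK ?prime_gt0 ?leqnn.
have M_gt0 := char_data_M_gt0 cD.
have M_dv : M %| #|G| by case: cD.
have [w prim_w] := Fp_prim_root r_pr M_gt0 (dvdn_trans M_dv r_dv).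
pose pr' u := if u == v then r else pr u.
have pr'v : pr' v = r by rewrite /pr' eqxx.
have neq_v u : u \in s -> u != v by apply: contraTneq => ->.
have pr's u : u \in s -> pr' u = pr u by move=> su; rewrite /pr' (negPf (neq_v u su)).
have pr_dv u : u \in s -> pr u %| #|G|.
  by move=> su; rewrite divG ?pr_pr // map_f.
have pr_neq u : u \in s -> pr u != r.
  by move=> su; apply: contraNneq nrG => <-; apply: pr_dv.
have prset_old (A : pred W) : ~~ A v -> prset pr A =1 prset pr' A.
  move=> nAv t; apply: eq_existsb => u; rewrite /pr'.
  by case: (eqVneq u v) => [->|//]; rewrite (negPf nAv).
have prset_new (A : pred W) : A v ->
    (fun t => prset pr (fun u => A u && (u != v)) t || (t == r)) =1 prset pr' A.
  move=> Av t; apply/orP/existsP=> [[/existsP[u /andP[/andP[Au nuv] eqt]] | /eqP->] | [u]].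
  - by exists u; rewrite Au /pr' (negPf nuv).
  - by exists v; rewrite Av pr'v eqxx.
  rewrite /pr'; case: (eqVneq u v) => [_ | nuv] /andP[Au eqt].
    by right; rewrite eq_sym.
  by left; apply/existsP; exists u; rewrite Au nuv.
have nr (A : pred W) : (forall u, A u -> u \in s) -> ~~ prset pr A r.
  move=> sA; apply/existsP=> -[u /andP[/sA su]]; exact/negP/pr_neq.
have adj_new u : u \in s -> adj (ext_group G K chi w) (pr u) r = ~~ e u v.
  move=> su; rewrite (ext_adj_new cD r_pr nrG prim_w) ?pr_pr ?pr_dv //.
  rewrite (prset_mem inj_pr) //; first by rewrite /low su.
  by move=> x /andP[].
exists pr', _, (ext_group G K chi w); split.
- split.
  + exact: ext_sol.
  + move=> u; rewrite inE => /predU1P[->|su]; first by rewrite pr'v.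
    by rewrite pr's ?pr_pr.
  + move=> u u'; rewrite !inE => /predU1P[->|su] /predU1P[->|su'] //.
    * by rewrite pr'v pr's // => /esym/eqP; rewrite (negPf (pr_neq _ su')).
    * by rewrite pr'v pr's // => /eqP; rewrite (negPf (pr_neq _ su)).
    * by rewrite !pr's //; apply: inj_pr.
  + move=> t t_pr; rewrite (ext_pdiv cD r_pr nrG prim_w) // divG //= inE pr'v orbC.
    by congr (_ || (_ \in _)); apply/eq_in_map=> u su; rewrite pr's.
  move=> u u'; rewrite !inE => /predU1P[->|su] /predU1P[->|su']; rewrite ?eqxx //.
  + by move=> _; rewrite pr'v pr's // adjC adj_new // e_sym.
  + by move=> _; rewrite pr'v pr's // adj_new.
  by move=> nuu'; rewrite !pr's // (ext_adj_old K chi w r_pr nrG) ?pr_pr ?pr_dv ?adjG.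
- move=> A sA; have [Av | nAv] := boolP (A v); last first.
    have sAs u : A u -> (u \in s) && (c u == 0 :> nat).
      move=> Au; have := sA u Au; rewrite inE.
      by case: (eqVneq u v) Au => [->|//]; rewrite (negPf nAv).
    have [M' [chi' cD']] := fullG sAs.
    exists M', (fun x => chi' x.2).
    have nr' : ~~ prset pr A r by apply: nr => u /sAs/andP[].
    apply: char_data_eq (char_data_pullback K chi w r_pr nrG cD' nr') (prset_old A nAv) _.
    apply/setIidPl; rewrite -sub_morphim_pre ?subsetT //.
    by rewrite (ext_projE G K chi w).
  have /andP[_ cv0] := sA v Av.
  have eKG : K = G by apply/group_inj/KG; rewrite (eqP cv0).
  subst K; pose A' u := A u && (u != v).
  have sAs u : A' u -> (u \in s) && (c u == 0 :> nat).
    by move=> /andP[/sA + nuv]; rewrite inE (negPf nuv).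
  have [M' [chi' cD']] := fullG sAs.
  (* Vertices of color 0 are not joined to v, which has color 0 too. *)
  have disj t : prset pr A' t -> ~~ prset pr low t.
    case/existsP=> u /andP[/sAs/andP[su cu0] /eqP <-].
    rewrite (prset_mem inj_pr) // => [|x /andP[]//]; rewrite /low su /=.
    by apply: contraTN cv0 => /c_proper; rewrite -val_eqE /= (eqP cu0) eq_sym.
  exists (r * M')%N, (prod_chi M' chi').
  apply: char_data_eq (prod_char_data cD r_pr nrG prim_w cD' disj) (prset_new A Av) _.
  by apply: prod_char_full => //; apply: chi0.
move=> A sA indA; have [Av | nAv] := boolP (A v); last first.
  have sAs u : A u -> (u \in s) && (c u < 2).
    move=> Au; have := sA u Au; rewrite inE.
    by case: (eqVneq u v) Au => [->|//]; rewrite (negPf nAv).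
  have [K' [M' [chi' cD']]] := indepG sAs indA.
  have nr' : ~~ prset pr A r by apply: nr => u /sAs/andP[].
  eexists; exists M', (fun x => chi' x.2).
  by apply: char_data_eq (char_data_pullback K chi w r_pr nrG cD' nr') (prset_old A nAv) _.
have /andP[_ cv2] := sA v Av.
have eKG : K = G by apply/group_inj/KG.
subst K; pose A' u := A u && (u != v).
have sAs u : A' u -> (u \in s) && (c u < 2).
  by move=> /andP[/sA + nuv]; rewrite inE (negPf nuv).
have indA' u u' : A' u -> A' u' -> ~~ e u u'.
  by move=> /andP[Au _] /andP[Au' _]; apply: indA.
have [K' [M' [chi' cD']]] := indepG sAs indA'.
have disj t : prset pr A' t -> ~~ prset pr low t.
  case/existsP=> u /andP[A'u /eqP <-]; have /andP[su _] := sAs u A'u.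
  rewrite (prset_mem inj_pr) // => [|x /andP[]//]; rewrite /low su /=.
  by apply: indA => //; case/andP: A'u.
eexists; exists (r * M')%N, (prod_chi M' chi').
by apply: char_data_eq (prod_char_data cD r_pr nrG prim_w cD' disj) (prset_new A Av) _.
Qed.

End Step.

Lemma realize_vertices : exists pr (gT : finGroupType) (G : {group gT}),
  realizes (enum W) pr G.
Proof.
(* The induction adds the head of the list last, so sorting by decreasing color adds vertices by
   increasing color. *)
pose leT := fun u v : W => c v <= c u.
suffices main s : uniq s -> sorted leT s -> exists pr (gT : finGroupType) (G : {group gT}),
    [/\ realizes s pr G, full_chars s pr G & indep_chars s pr G].
  have leT_total : total leT by move=> u v; apply: leq_total.
  have [||pr [gT [G [[solG pr_pr inj_pr divG adjG] _ _]]]] := main (sort leT (enum W)).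
  - by rewrite sort_uniq enum_uniq.
  - exact: sort_sorted.
  exists pr, gT, G; split=> //.
  - by move=> v Wv; apply: pr_pr; rewrite mem_sort.
  - by move=> u v Wu Wv; apply: inj_pr; rewrite mem_sort.
  - move=> t t_pr; rewrite divG //; apply/mapP/mapP=> -[u su ->]; exists u => //.
      by rewrite mem_sort in su.
    by rewrite mem_sort.
  by move=> u v Wu Wv; apply: adjG; rewrite mem_sort.
elim: s => [_ _ | v s IHs /= /andP[nsv uniq_s] sorted_s].
  exists (fun _ => 0), {perm 'I_1}, 1%G; split.
  - split=> //; first exact: solvable1.
    by move=> t t_pr; rewrite cards1 dvdn1 in_nil; apply/negbTE; rewrite neq_ltn prime_gt1 ?orbT.
  - move=> A A0; exists 1%N, (fun _ => 0); apply: trivial_char_data => u.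
    by apply/negP=> /A0.
  move=> A A0 _; exists 1%G, 1%N, (fun _ => 0); apply: trivial_char_data => u.
  by apply/negP=> /A0.
have leT_trans : transitive leT by move=> x y z /= le1 le2; apply: leq_trans le2 le1.
have [pr [gT [G [realG fullG indepG]]]] := IHs uniq_s (path_sorted sorted_s).
apply: (realize_step nsv _ realG fullG indepG) => u su.
by have /allP := order_path_min leT_trans sorted_s; apply.
Qed.

End Realize.

Theorem theorem6p2 (Gamma : sgraph) :
  (exists (gT : finGroupType) (G : {group gT}),
     pseudo_PSL33_solvable G /\ graph_iso Gamma (prime_graph G)) <->
  (colorable 3 (complement Gamma) /\ triangle_free (complement Gamma)).
Proof.
split=> [[gT [G [psG [f bij_f edge_f]]]] | [[c c_proper] tri]].
  have inj_f := bij_inj bij_f.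
  have fP x : prime (val (f x)) /\ val (f x) %| #|G|.
    by have := valP (f x); rewrite mem_primes => /and3P[].
  have nedgeP x y : edge (s := complement Gamma) x y ->
      val (f x) != val (f y) /\ ~~ adj G (val (f x)) (val (f y)).
    move=> /andP[nxy]; rewrite -edge_f /= /prime_edge (inj_eq inj_f) nxy /= => nadj.
    by rewrite (inj_eq val_inj) (inj_eq inj_f).
  split.
    have [c cP] := pseudo_coloring psG.
    exists (fun x => c (val (f x))) => x y /nedgeP[nxy nadj].
    by have [[? ?] [? ?]] := (fP x, fP y); apply: cP.
  move=> x y z; apply/and3P=> -[/nedgeP[nxy axy] /nedgeP[nyz ayz] /nedgeP[nxz axz]].
  have [px dx] := fP x; have [py dy] := fP y; have [pz dz] := fP z.
  have := pseudo_three_primes psG px py pz nxy nyz nxz dx dy dz.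
  by rewrite (negPf axy) (negPf ayz) (negPf axz).
have [pr [gT [G [solG pr_pr inj_pr divG adjG]]]] :=
  realize_vertices (@compl_edge_sym Gamma) c_proper tri.
exists gT, G; split; first exact: sol_pseudo.
have inW (v : vertex Gamma) : v \in enum (vertex Gamma) by rewrite mem_enum.
have {}inj_pr : injective pr by move=> u v; apply: inj_pr.
have prG v : pr v \in primes #|G|.
  by rewrite mem_primes pr_pr // cardG_gt0 divG ?pr_pr ?map_f.
pose f v := SeqSub (prG v).
have inj_f : injective f by move=> u v /(congr1 val)/inj_pr.
(* Bijectivity follows by counting: every prime divisor of |G| is some [pr v]. *)
exists f => [|x y].
  apply: inj_card_bij => //; rewrite card_seq_sub ?primes_uniq //.
  rewrite [leqRHS]cardE -(size_map pr); apply: uniq_leq_size; first exact: primes_uniq.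
  by move=> t; rewrite mem_primes => /and3P[t_pr _]; rewrite divG.
rewrite /= /prime_edge (inj_eq inj_f).
have [-> | nxy] := eqVneq x y; first by rewrite edge_irrefl.
have := adjG x y (inW x) (inW y) nxy; rewrite /adj /= => ->.
by rewrite /compl_edge nxy negbK.
Qed.
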